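(* Let $T$ be the Jacobi operator associated to a given indeterminate Hamburger moment sequence $s$. Then, in the unitary equivalence class of $T$, $T$ is the only Jacobi operator associated to a moment sequence; that is, if $T'$ is a Jacobi operator associated to an indeterminate moment sequence $s'$ and $T'$ is unitarily equivalent to $T$, then $T'=T$.
   Context: Let $s=\{s_i\}_{i=0}^\infty$ be a real sequence with $s_0=1$ (all moment sequences are normalized this way) that is positive-definite: $\sum_{i,j=0}^n s_{i+j}\xi_i\overline{\xi_j}>0$ for all $n$ and all nonzero $(\xi_0,\dots,\xi_n)\in\mathbb{C}^{n+1}$. It is indeterminate if there is more than one positive Borel measure $\mu$ on $\mathbb{R}$ with $s_i=\int x^i d\mu$ for all $i\ge0$. On polynomials use the inner product determined by $(\lambda^i,\lambda^j)=s_{i+j}$; Gram–Schmidt applied to $1,\lambda,\lambda^2,\dots$ gives the orthonormal polynomials $P_n$ (real coefficients, positive leading coefficient, $P_0\equiv1$), which satisfy $\lambda P_n=a_nP_{n+1}+b_nP_n+a_{n-1}P_{n-1}$ with $a_n>0$, $b_n\in\mathbb{R}$, $P_{-1}\equiv0$. The Jacobi operator $T$ associated to $s$ is the closure in $l^2(\mathbb{N}_0)$ of the operator on finite sequences given by $Te_n=a_ne_{n+1}+b_ne_n+a_{n-1}e_{n-1}$, $e_{-1}:=0$, where $\{e_n\}$ is the standard basis. Two operators $T,T'$ are unitarily equivalent if $T'=UTU^{-1}$ (including domains) for a unitary $U$. *)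

(* Defs.v *)
From HB Require Import structures.
From mathcomp Require Import all_boot all_order all_algebra.
From mathcomp Require Import all_classical all_reals all_analysis.
From mathcomp Require Export complex.
From mathcomp Require Import lra.
Set Implicit Arguments.
Unset Strict Implicit.
Unset Printing Implicit Defensive.
Import Order.TTheory GRing.Theory Num.Theory numFieldNormedType.Exports.
Import ComplexField.Normc.
Local Open Scope classical_set_scope.
Local Open Scope ring_scope.

Section MomentSequences.
Variable R : realType.
Implicit Types s : nat -> R.

(* [0 < z] on [R[i]] says that z is real and positive. *)
Definition positive_definite s : Prop :=
  forall (n : nat) (xi : 'I_n.+1 -> R[i]), (exists i, xi i != 0) ->
    0 < \sum_(i < n.+1) \sum_(j < n.+1)
          (s (i + j)%N)%:C%C * xi i * (xi j)^*.

Definition has_moments (mu : {measure set R -> \bar R}) s : Prop :=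
  forall n : nat, mu.-integrable setT (fun x : R => (x ^+ n)%:E) /\
    (\int[mu]_x (x ^+ n)%:E = (s n)%:E)%E.

(* Two measures are distinguished by a Borel set: [measure] records also carry
   values on non-measurable sets, which must not count. *)
Definition indeterminate s : Prop :=
  exists mu nu : {measure set R -> \bar R},
    [/\ has_moments mu s, has_moments nu s &
        exists A : set R, measurable A /\ mu A <> nu A].

Definition indeterminate_moment_sequence s : Prop :=
  [/\ s 0%N = 1, positive_definite s & indeterminate s].

(* The inner product on polynomials with ('X^i, 'X^j) = s (i + j). *)
Definition mdot s (p q : {poly R}) : R :=
  \sum_(i < size p) \sum_(j < size q) p`_i * q`_j * s (i + j)%N.

Definition gram_schmidt_step s (ps : seq {poly R}) (n : nat) : {poly R} :=
  let q := 'X^n - \sum_(p <- ps) mdot s 'X^n p *: p in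
  (Num.sqrt (mdot s q q))^-1 *: q.

Fixpoint orthopolys s (n : nat) : seq {poly R} :=
  if n is m.+1 then
    rcons (orthopolys s m) (gram_schmidt_step s (orthopolys s m) m)
  else [::].

Definition orthopoly s (n : nat) : {poly R} :=
  gram_schmidt_step s (orthopolys s n) n.

(* The coefficients of the three-term recurrence, read off by taking inner
   products; that the recurrence holds is [three_term_recurrence] below. *)
Definition jacobi_a s (n : nat) : R :=
  mdot s ('X * orthopoly s n) (orthopoly s n.+1).

Definition jacobi_b s (n : nat) : R :=
  mdot s ('X * orthopoly s n) (orthopoly s n).

End MomentSequences.

Section OrthonormalPolynomials.
Variables (R : realType) (s : nat -> R).
Hypothesis s_pd : positive_definite s.
Implicit Types p q r : {poly R}.
Local Notation P := (orthopoly s).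
Local Notation a := (jacobi_a s).
Local Notation b := (jacobi_b s).

Lemma mdotE m n p q : (size p <= m)%N -> (size q <= n)%N ->
  mdot s p q = \sum_(i < m) \sum_(j < n) p`_i * q`_j * s (i + j)%N.
Proof.
move=> pm qn; rewrite /mdot.
pose F i := \sum_(j < n) p`_i * q`_j * s (i + j)%N.
have -> : \sum_(i < m) \sum_(j < n) p`_i * q`_j * s (i + j)%N
    = \sum_(i < size p) F i.
  rewrite (big_ord_widen _ F pm) [LHS](bigID (fun i : 'I_m => (i < size p)%N)) /=.
  rewrite [X in _ + X]big1 ?addr0// => i; rewrite -leqNgt => ip.
  by rewrite big1// => j _; rewrite nth_default// !mul0r.
apply: eq_bigr => i _.
pose G j := p`_i * q`_j * s (i + j)%N.
rewrite /F (big_ord_widen _ G qn).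
rewrite [RHS](bigID (fun j : 'I_n => (j < size q)%N)) /=.
rewrite [X in _ = _ + X]big1 ?addr0// => j; rewrite -leqNgt => jq.
by rewrite [q`_j]nth_default// mulr0 mul0r.
Qed.

Lemma mdotC p q : mdot s p q = mdot s q p.
Proof.
rewrite /mdot exchange_big; apply: eq_bigr => i _; apply: eq_bigr => j _ /=.
by rewrite addnC [_`_j * _]mulrC.
Qed.

Lemma mdotDZl c p q r : mdot s (c *: p + q) r = c * mdot s p r + mdot s q r.
Proof.
pose m := maxn (size (c *: p + q)) (maxn (size p) (size q)).
rewrite (@mdotE m (size r)) ?leq_max ?leqnn//.
rewrite (@mdotE m (size r) p) ?leq_max ?leqnn ?orbT//.
rewrite (@mdotE m (size r) q) ?leq_max ?leqnn ?orbT//.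
rewrite mulr_sumr -big_split/=; apply: eq_bigr => i _.
rewrite mulr_sumr -big_split/=; apply: eq_bigr => j _.
by rewrite coefD coefZ !mulrDl !mulrA.
Qed.

Lemma mdot0l r : mdot s 0 r = 0.
Proof. by rewrite /mdot size_poly0 big_ord0. Qed.

Lemma mdotDl p q r : mdot s (p + q) r = mdot s p r + mdot s q r.
Proof. by have := mdotDZl 1 p q r; rewrite scale1r mul1r. Qed.

Lemma mdotZl c p r : mdot s (c *: p) r = c * mdot s p r.
Proof. by have := mdotDZl c p 0 r; rewrite addr0 mdot0l addr0. Qed.

Lemma mdotBl p q r : mdot s (p - q) r = mdot s p r - mdot s q r.
Proof. by rewrite addrC -scaleN1r mdotDZl mulN1r addrC. Qed.

Lemma mdot_suml (I : Type) (l : seq I) (F : I -> {poly R}) r :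
  mdot s (\sum_(i <- l) F i) r = \sum_(i <- l) mdot s (F i) r.
Proof. exact: (big_morph (fun p => mdot s p r) (fun _ _ => mdotDl _ _ _) (mdot0l r)). Qed.

Lemma mdotX p q : mdot s ('X * p) q = mdot s p ('X * q).
Proof.
have szX r : (size ('X * r)%R <= (size r).+1)%N.
  by rewrite (leq_trans (size_polyMleq _ _))// size_polyX addSn.
have E u v : mdot s ('X * u) v =
    \sum_(i < size u) \sum_(j < size v) u`_i * v`_j * s (i + j).+1.
  rewrite (@mdotE (size u).+1 (size v))// big_ord_recl/= big1 ?add0r.
    apply: eq_bigr => i _; apply: eq_bigr => j _.
    by rewrite coefXM /= /bump leq0n add1n addSn.
  by move=> j _; rewrite coefXM/= !mul0r.
rewrite E mdotC E exchange_big; apply: eq_bigr => i _; apply: eq_bigr => j _ /=.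
by rewrite addnC [_`_j * _]mulrC.
Qed.

Lemma mdot_gt0 p : p != 0 -> 0 < mdot s p p.
Proof.
move=> p0; have szp : (0 < size p)%N by rewrite size_poly_gt0.
have := @s_pd (size p).-1 (fun i => (p`_i)%:C%C).
have -> : \sum_(i < (size p).-1.+1) \sum_(j < (size p).-1.+1)
     (s (i + j)%N)%:C%C * (p`_i)%:C%C * ((p`_j)%:C%C)^* = (mdot s p p)%:C%C.
  rewrite (@mdotE (size p).-1.+1 (size p).-1.+1) ?prednK// rmorph_sum.
  apply: eq_bigr => i _; rewrite rmorph_sum; apply: eq_bigr => j _ /=.
  have -> : ((p`_j)%:C%C)^* = (p`_j)%:C%C := conjc_real _.
  by rewrite !rmorphM/= -mulrA mulrC.
rewrite ltcE /= eqxx /=; apply.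
have H : ((size p).-1 < (size p).-1.+1)%N by [].
exists (Ordinal H); rewrite /= -[p`__]/(lead_coef p).
by rewrite eq_complex/= eqxx andbT lead_coef_eq0.
Qed.

Lemma size_sum_le n (F : nat -> {poly R}) :
  (forall i, (i < n)%N -> (size (F i) <= n)%N) ->
  (size (\sum_(0 <= i < n) F i)%R <= n)%N.
Proof.
move=> Fn; rewrite big_mkord (leq_trans (size_sum _ _ _))//.
by apply/bigmax_leqP => i _; exact: Fn.
Qed.

Lemma orthopolysE n : orthopolys s n = [seq P i | i <- iota 0 n].
Proof.
elim: n => [//|n IH]; rewrite -addn1 iotaD map_cat -IH add0n /= addn1 /=.
by rewrite cats1.
Qed.

Let q_ n := 'X^n - \sum_(0 <= i < n) mdot s 'X^n (P i) *: P i.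

Let PE n : P n = (Num.sqrt (mdot s (q_ n) (q_ n)))^-1 *: q_ n.
Proof.
rewrite [LHS]/orthopoly /gram_schmidt_step orthopolysE big_map.
by rewrite /q_ /index_iota subn0.
Qed.

Let orth n : [/\ size (P n) = n.+1, 0 < lead_coef (P n),
  mdot s (P n) (P n) = 1 & forall i, (i < n)%N -> mdot s (P n) (P i) = 0].
Proof.
elim/ltn_ind: n => n IH.
have szS : (size (\sum_(0 <= i < n) mdot s 'X^n (P i) *: P i)%R <= n)%N.
  apply: size_sum_le => i ilt.
  by rewrite (leq_trans (size_scale_leq _ _))//; have [->] := IH i ilt.
have szq : size (q_ n) = n.+1.
  by rewrite /q_ size_polyDl ?size_polyXn// size_polyN ltnS.
have q0 : q_ n != 0 by rewrite -size_poly_eq0 szq.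
have lq : lead_coef (q_ n) = 1.
  by rewrite /q_ lead_coefDl ?lead_coefXn// size_polyN size_polyXn ltnS.
have nq := mdot_gt0 q0.
have sq0 : 0 < (Num.sqrt (mdot s (q_ n) (q_ n)))^-1.
  by rewrite invr_gt0 sqrtr_gt0.
split.
- by rewrite PE size_scale ?gt_eqF.
- by rewrite PE lead_coefZ lq mulr1.
- rewrite PE mdotZl mdotC mdotZl mulrA -expr2 exprVn sqr_sqrtr ?ltW//.
  by rewrite mulVf// gt_eqF.
- move=> i ilt; rewrite PE mdotZl; move: (_^-1) => c; rewrite /q_ mdotBl mdot_suml.
  rewrite (bigD1_seq i)/= ?mem_index_iota ?iota_uniq//.
  rewrite mdotZl; have [_ _ -> _] := IH i ilt.
  rewrite mulr1 big_seq_cond big1 ?addr0 ?subrr ?mulr0// => j.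
  rewrite mem_index_iota => /andP[/andP[_ jlt] ji]; rewrite mdotZl.
  move: ji; rewrite neq_ltn => /orP[ji|ij].
    by rewrite [mdot s (P j) _]mdotC; have [_ _ _ ->] := IH i ilt; rewrite ?mulr0.
  by have [_ _ _ ->] := IH j jlt; rewrite ?mulr0.
Qed.

Lemma size_orthopoly n : size (P n) = n.+1.
Proof. by have [] := orth n. Qed.

Lemma lead_coef_orthopoly n : 0 < lead_coef (P n).
Proof. by have [] := orth n. Qed.

Lemma orthopoly_orthonormal m n : mdot s (P m) (P n) = (m == n)%:R.
Proof.
have [mn|nm|->] := ltngtP m n; last by have [] := orth n.
  by rewrite mdotC; have [_ _ _ ->] := orth n.
by have [_ _ _ ->] := orth m.
Qed.

Lemma orthopoly0 : s 0%N = 1 -> P 0%N = 1.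
Proof.
move=> s0; have : size (P 0%N) == 1%N by rewrite size_orthopoly.
move=> /size_poly1P[c c0 Pc]; have := lead_coef_orthopoly 0.
have := orthopoly_orthonormal 0 0.
rewrite Pc /mdot size_polyC c0 !big_ord1 coefC eqxx addn0 s0 mulr1 lead_coefC.
rewrite -expr2 => /eqP; rewrite -subr_eq0 subr_sqr_1 mulf_eq0.
by rewrite subr_eq0 addr_eq0 => /orP[/eqP->//|/eqP->]; rewrite oppr_gt0 ltr10.
Qed.

Lemma orthopoly_expansion p n : (size p <= n)%N ->
  p = \sum_(0 <= i < n) mdot s p (P i) *: P i.
Proof.
move=> pn; apply/eqP; rewrite -subr_eq0; apply/negPn/negP.
set r := p - _ => r0.
have rP i : (i < n)%N -> mdot s r (P i) = 0.
  move=> ilt; rewrite /r mdotBl mdot_suml (bigD1_seq i)/= ?mem_index_iota ?iota_uniq//.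
  rewrite mdotZl orthopoly_orthonormal eqxx mulr1 big1 ?addr0 ?subrr// => j ji.
  by rewrite mdotZl orthopoly_orthonormal (negbTE ji) mulr0.
have szr : (size r <= n)%N.
  rewrite /r (leq_trans (size_polyD _ _))// geq_max pn size_polyN.
  apply: size_sum_le => i ilt.
  by rewrite (leq_trans (size_scale_leq _ _))// size_orthopoly.
have rq m (q : {poly R}) : (m <= n)%N -> (size q <= m)%N -> mdot s r q = 0.
  elim: m q => [|m IHm] q mn.
    by rewrite leqn0 size_poly_eq0 => /eqP->; rewrite mdotC mdot0l.
  move=> qm; pose c := q`_m / lead_coef (P m).
  have l0 : lead_coef (P m) != 0 by rewrite gt_eqF// lead_coef_orthopoly.
  have -> : q = c *: P m + (q - c *: P m) by rewrite addrC subrK.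
  rewrite mdotC mdotDZl mdotC rP// mulr0 add0r mdotC IHm ?(ltnW mn)//.
  apply/leq_sizeP => j; rewrite leq_eqVlt => /orP[/eqP<-|mj].
    rewrite coefB coefZ /c.
    have -> : lead_coef (P m) = (P m)`_m by rewrite /lead_coef size_orthopoly.
    have lm : (P m)`_m != 0 by move: l0; rewrite /lead_coef size_orthopoly.
    by rewrite divfK ?subrr.
  rewrite coefB coefZ !nth_default ?mulr0 ?subrr// ?size_orthopoly//.
  exact: leq_trans mj.
by have := mdot_gt0 r0; rewrite (rq n)// ltxx.
Qed.

Let sizeXP n : (size ('X * P n)%R <= n.+2)%N.
Proof. by rewrite (leq_trans (size_polyMleq _ _))// size_polyX size_orthopoly. Qed.

Lemma jacobi_a_gt0 n : 0 < a n.
Proof.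
have S0 : (\sum_(0 <= i < n.+1) mdot s ('X * P n) (P i) *: P i)`_n.+1 = 0.
  by rewrite nth_default//; apply: size_sum_le => i ilt;
     rewrite (leq_trans (size_scale_leq _ _))// size_orthopoly.
have : ('X * P n)`_n.+1 = a n * (P n.+1)`_n.+1.
  rewrite {1}(orthopoly_expansion (sizeXP n)) big_nat_recr//= coefD S0 add0r.
  by rewrite coefZ.
rewrite coefXM/=; have := lead_coef_orthopoly n.+1; have := lead_coef_orthopoly n.
rewrite /lead_coef !size_orthopoly/= => l l1 E1.
by rewrite -(pmulr_lgt0 _ l1) -E1.
Qed.

Lemma three_term_recurrence n : 'X * P n =
  a n *: P n.+1 + b n *: P n + (if n is m.+1 then a m *: P m else 0).
Proof.
rewrite {1}(orthopoly_expansion (sizeXP n)) !big_nat_recr//= -/(a n) -/(b n).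
rewrite -addrA [_ + a n *: _]addrC addrC; congr (_ + _).
case: n => [|n]; first by rewrite big_nil.
rewrite big_nat_recr//= mdotX mdotC -/(a n) big_seq big1 ?add0r// => i.
rewrite mem_index_iota => /andP[_ ilt].
rewrite mdotX mdotC (orthopoly_expansion (sizeXP i)) mdot_suml big_seq big1 ?scale0r//.
move=> j; rewrite mem_index_iota => /andP[_ jlt].
rewrite mdotZl orthopoly_orthonormal ltn_eqF ?mulr0//.
by rewrite (leq_trans jlt).
Qed.

End OrthonormalPolynomials.

Section SquareSummable.
Variable R : realType.
Implicit Types x y : nat -> R[i].

Definition sqnorm_series x : nat -> R := series (fun k => normc (x k) ^+ 2).

Definition square_summable x : Prop := cvgn (sqnorm_series x).

Lemma sqnorm_series_nd x : nondecreasing_seq (sqnorm_series x).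
Proof. by apply: nondecreasing_series => *; rewrite sqr_ge0. Qed.

Lemma sqnorm_series_ge0 x n : 0 <= sqnorm_series x n.
Proof. by apply: sumr_ge0 => *; rewrite sqr_ge0. Qed.

Lemma square_summable_bounded x M :
  (forall n, sqnorm_series x n <= M) -> square_summable x.
Proof.
move=> xM; apply: nondecreasing_is_cvgn; first exact: sqnorm_series_nd.
by exists M => _ [n _ <-].
Qed.

Lemma sqnorm_series_le_lim x n : square_summable x ->
  sqnorm_series x n <= limn (sqnorm_series x).
Proof. by move=> cx; apply: nondecreasing_cvgn_le => //; exact: sqnorm_series_nd. Qed.

Lemma lim_sqnorm_series_ge0 x : square_summable x ->
  0 <= limn (sqnorm_series x).
Proof.
by move=> cx; apply: limr_ge => //; apply: nearW => n; exact: sqnorm_series_ge0.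
Qed.

Lemma sqnorm_series_triangle x y n :
  Num.sqrt (sqnorm_series (x + y) n) <=
  Num.sqrt (sqnorm_series x n) + Num.sqrt (sqnorm_series y n).
Proof.
elim: n => [|n IH].
  by rewrite /sqnorm_series /series/= !big_geq// sqrtr0 addr0.
have S z : Num.sqrt (sqnorm_series z n.+1) =
    normc (Num.sqrt (sqnorm_series z n) +i* normc (z n))%C.
  rewrite /normc sqr_sqrtr ?sqnorm_series_ge0//.
  by rewrite /sqnorm_series seriesSr.
have nc0 z : 0 <= normc z :> R by case: z => u v /=; rewrite sqrtr_ge0.
have mono (u v u' v' : R) : 0 <= u -> 0 <= v -> u <= u' -> v <= v' ->
    normc (u +i* v)%C <= normc (u' +i* v')%C.
  move=> u0 v0 uu' vv'; rewrite /= ler_sqrt ?addr_ge0 ?sqr_ge0//.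
  by apply: lerD; rewrite ler_sqr ?nnegrE// (le_trans _ uu', le_trans _ vv').
rewrite !S; apply: le_trans (le_normcD _ _).
by apply: mono => //; exact: le_normcD.
Qed.

Lemma sqnorm_series_add x y n : square_summable x -> square_summable y ->
  sqnorm_series (x + y) n <=
  (Num.sqrt (limn (sqnorm_series x)) + Num.sqrt (limn (sqnorm_series y))) ^+ 2.
Proof.
move=> cx cy; rewrite -[leLHS]sqr_sqrtr ?sqnorm_series_ge0//.
rewrite ler_sqr ?nnegrE ?addr_ge0 ?sqrtr_ge0//.
apply: le_trans (sqnorm_series_triangle _ _ _) _.
by apply: lerD; rewrite ler_sqrt ?lim_sqnorm_series_ge0// sqnorm_series_le_lim.
Qed.

Lemma sqnorm_seriesZ c x :
  sqnorm_series (c *: x) = (fun n => normc c ^+ 2 * sqnorm_series x n).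
Proof.
apply/funext => n; rewrite /sqnorm_series /series/= mulr_sumr.
by apply: eq_bigr => i _; rewrite -exprMn -normcM.
Qed.

Lemma square_summable0 : square_summable 0.
Proof.
apply: (@square_summable_bounded _ 0) => n.
by rewrite /sqnorm_series /series/= big1// => i _; rewrite !expr0n addr0 sqrtr0 expr0n.
Qed.

Lemma square_summableD x y :
  square_summable x -> square_summable y -> square_summable (x + y).
Proof.
move=> cx cy; apply: square_summable_bounded => n.
exact: sqnorm_series_add.
Qed.

Lemma square_summableZ c x : square_summable x -> square_summable (c *: x).
Proof.
by move=> cx; rewrite /square_summable sqnorm_seriesZ; apply: is_cvgMr.
Qed.

Definition square_summable_pred : {pred nat -> R[i]} :=
  [pred x | `[< square_summable x >]].

Lemma square_summable_submod_closed : submod_closed square_summable_pred.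
Proof.
split; first by apply/asboolP; exact: square_summable0.
move=> c x y /asboolP cx /asboolP cy; apply/asboolP.
by apply: square_summableD => //; exact: square_summableZ.
Qed.

HB.instance Definition _ := GRing.isSubmodClosed.Build R[i] (nat -> R[i])
  square_summable_pred square_summable_submod_closed.

Record l2 := L2 { l2val :> nat -> R[i]; _ : l2val \in square_summable_pred }.

HB.instance Definition _ := [isSub for l2val].
HB.instance Definition _ := [Choice of l2 by <:].
HB.instance Definition _ := [SubChoice_isSubLmodule of l2 by <:].

Lemma l2P (x : l2) : square_summable x.
Proof. by case: x => x /= /asboolP. Qed.

Definition l2norm (x : l2) : R := Num.sqrt (limn (sqnorm_series x)).

Let l2normC (x : l2) : R[i] := (l2norm x)%:C%C.

Let l2normCD (x y : l2) : l2normC (x + y) <= l2normC x + l2normC y.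
Proof.
rewrite /l2normC -rmorphD/= lecR /l2norm.
have xy0 := addr_ge0 (sqrtr_ge0 (limn (sqnorm_series x)))
  (sqrtr_ge0 (limn (sqnorm_series y))).
rewrite -[leRHS]ger0_norm// -sqrtr_sqr ler_sqrt ?sqr_ge0//.
apply: limr_le; first exact: l2P.
by apply: nearW => n; apply: sqnorm_series_add; exact: l2P.
Qed.

Let l2normCZ (c : R[i]) (x : l2) : l2normC (c *: x) = `|c| * l2normC x.
Proof.
have nc0 z : 0 <= normc z :> R by case: z => u v /=; rewrite sqrtr_ge0.
have -> : `|c| = (normc c)%:C%C by [].
rewrite /l2normC -rmorphM/= /l2norm sqnorm_seriesZ; congr (_%:C)%C.
have -> : limn (fun n => normc c ^+ 2 * sqnorm_series x n) =
    normc c ^+ 2 * limn (sqnorm_series x).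
  by apply: cvg_lim => //; apply: cvgMr; exact: l2P.
by rewrite sqrtrM ?sqr_ge0// sqrtr_sqr ger0_norm.
Qed.

Let l2normC_eq0 (x : l2) : l2normC x = 0 -> x = 0.
Proof.
move=> /eqP; rewrite eq_complex/= eqxx andbT sqrtr_eq0 => x0.
apply/val_inj/funext => k /=; apply: eq0_normc.
apply/eqP; rewrite -sqrf_eq0 eq_le sqr_ge0 andbT.
apply: le_trans x0; apply: (@le_trans _ _ (sqnorm_series x k.+1)).
  by rewrite /sqnorm_series seriesSr lerDr; exact: sqnorm_series_ge0.
by apply: sqnorm_series_le_lim; exact: l2P.
Qed.

HB.instance Definition _ :=
  Lmodule_isNormed.Build R[i] l2 l2normCD l2normCZ l2normC_eq0.

Lemma l2normE (x : l2) : `|x| = (l2norm x)%:C%C.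
Proof. by []. Qed.

Definition l2dot (x y : l2) : R[i] :=
  (limn (series (fun k => complex.Re (x k * (y k)^*))) +i*
   limn (series (fun k => complex.Im (x k * (y k)^*))))%C.

Lemma l2dot_is_cvg (x y : l2) :
  cvgn (series (fun k => complex.Re (x k * (y k)^*))) /\
  cvgn (series (fun k => complex.Im (x k * (y k)^*))).
Proof.
have nc0 z : 0 <= normc z :> R by case: z => u v /=; rewrite sqrtr_ge0.
have nJ (z : R[i]) : normc z^* = normc z :> R.
  by case: z => u v /=; rewrite sqrrN.
have bound (z w : R[i]) : normc (z * w^*) <= normc z ^+ 2 + normc w ^+ 2.
  rewrite normcM nJ; have := sqr_ge0 (normc z - normc w); rewrite sqrrB.
  have := mulr_ge0 (nc0 z) (nc0 w); lra.
have leRe (z : R[i]) : `|complex.Re z| <= normc z.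
  by case: z => u v; rewrite /= -sqrtr_sqr ler_sqrt ?addr_ge0 ?sqr_ge0// lerDl sqr_ge0.
have leIm (z : R[i]) : `|complex.Im z| <= normc z.
  by case: z => u v; rewrite /= -sqrtr_sqr ler_sqrt ?addr_ge0 ?sqr_ge0// lerDr sqr_ge0.
have cv (f : R[i] -> R) : (forall z, `|f z| <= normc z) ->
    cvgn (series (fun k => f (x k * (y k)^*))).
  move=> fle; apply: normed_cvg.
  apply: (@series_le_cvg _ _ (fun k => normc (x k) ^+ 2 + normc (y k) ^+ 2)).
  - by move=> k; exact: normr_ge0.
  - by move=> k; rewrite addr_ge0 ?sqr_ge0.
  - by move=> k; exact: le_trans (fle _) (bound _ _).
  - by apply: is_cvg_seriesD; exact: l2P.
by split; apply: cv.
Qed.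

Lemma l2dot_norm (x : l2) : l2dot x x = `|x| ^+ 2.
Proof.
rewrite l2normE -rmorphXn/= /l2norm sqr_sqrtr ?lim_sqnorm_series_ge0//; last exact: l2P.
have E k : x k * (x k)^* = (normc (x k) ^+ 2)%:C%C.
  by rewrite -normCK rmorphXn.
rewrite /l2dot; apply/eqP; rewrite eq_complex/=; apply/andP; split; apply/eqP.
  by congr (limn _); apply/funext => n; apply: eq_bigr => k _; rewrite E.
rewrite (_ : series _ = cst 0) ?lim_cst//; apply/funext => n.
by rewrite /series/= big1// => k _; rewrite E.
Qed.

Definition basis_fun (n : nat) : nat -> R[i] := fun k => (k == n)%:R.

Lemma basis_fun_square_summable n : basis_fun n \in square_summable_pred.
Proof.
apply/asboolP/(@square_summable_bounded _ 1) => m.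
rewrite /sqnorm_series /series/=.
have [nm|mn] := ltnP n m.
  rewrite (bigD1_seq n) ?mem_index_iota ?iota_uniq//= /basis_fun eqxx normc1.
  by rewrite expr1n big1 ?addr0// => k /negbTE ->; rewrite normc0 expr0n.
rewrite big_seq big1// => k; rewrite mem_index_iota => /andP[_ km].
by rewrite /basis_fun ltn_eqF ?normc0 ?expr0n// (leq_trans km).
Qed.

Definition l2basis (n : nat) : l2 := L2 (basis_fun_square_summable n).

End SquareSummable.

Section Operators.
Variable R : realType.
Local Notation H := (l2 R).
Local Notation e := (@l2basis R).

(* A (partially defined) operator in l^2 is identified with its graph. *)
Definition operator : Type := set (H * H).

Lemma closure_operatorP (T : operator) (x y : H) : closure T (x, y) <->
  forall eps : R, 0 < eps ->
    exists u v : H, [/\ T (u, v), l2norm (x - u) < eps & l2norm (y - v) < eps].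
Proof.
split=> [cT eps eps0|h].
  have eps0C : 0 < eps%:C%C by rewrite ltcE /= eqxx.
  have nb : nbhs (x, y) (ball x eps%:C%C `*` ball y eps%:C%C).
    by exists (ball x eps%:C%C, ball y eps%:C%C) => //=; split; exact: nbhsx_ballx.
  have [[u v] [Tuv [/= ux vy]]] := cT _ nb.
  exists u, v; split=> //.
    by move: ux; rewrite -ball_normE /ball_/= l2normE ltcR.
  by move: vy; rewrite -ball_normE /ball_/= l2normE ltcR.
move=> B [[B1 B2] /= [/nbhs_ballP[e1 /= e10 B1e] /nbhs_ballP[e2 /= e20 B2e]] BB].
have pos (z : R[i]) : 0 < z -> 0 < complex.Re z /\ z = (complex.Re z)%:C%C.
  case: z => u v; rewrite ltcE/= => /andP[/eqP v0 u0]; split => //.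
  by rewrite v0.
have [e1p e1E] := pos _ e10; have [e2p e2E] := pos _ e20.
have [] := h (Num.min (complex.Re e1) (complex.Re e2)).
  by rewrite lt_min e1p.
move=> u [v []]; rewrite !lt_min => Tuv /andP[xu _] /andP[_ yv].
exists (u, v); split => //; apply: BB; split => /=.
  by apply: B1e; rewrite -ball_normE /ball_/= l2normE e1E ltcR.
by apply: B2e; rewrite -ball_normE /ball_/= l2normE e2E ltcR.
Qed.

Definition jacobi_on_basis (a b : nat -> R) (n : nat) : H :=
  (a n)%:C%C *: e n.+1 + (b n)%:C%C *: e n +
  (if n is m.+1 then (a m)%:C%C *: e m else 0).

(* The linear extension to finite sequences. *)
Definition jacobi_finite (a b : nat -> R) : operator :=
  [set p | exists (N : nat) (c : nat -> R[i]),
    p = (\sum_(n < N) c n *: e n, \sum_(n < N) c n *: jacobi_on_basis a b n)].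

Definition jacobi_operator (s : nat -> R) : operator :=
  closure (jacobi_finite (jacobi_a s) (jacobi_b s)).

Definition unitary (U : {linear H -> H}) : Prop :=
  (forall y : H, exists x : H, U x = y) /\
  (forall x y : H, l2dot (U x) (U y) = l2dot x y).

(* T' = U T U^-1 with domain U (dom T): the graph of T' is the image of the
   graph of T under (x, y) |-> (U x, U y). *)
Definition unitarily_equivalent (T T' : operator) : Prop :=
  exists U : {linear H -> H}, unitary U /\
    T' = [set (U p.1, U p.2) | p in T].

End Operators.

(* Main.v *)
Require Import Defs.
From mathcomp Require Import all_boot all_order all_algebra.
From mathcomp Require Import all_classical all_reals all_analysis.
From mathcomp Require Import measurable_realfun cyclic separable cyclotomic ring lra zify.

(** Let p(z) be the sequence (P_0(z), P_1(z), ...).  The moment problem being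
    indeterminate, p(z) is square summable for every complex z, and it spans
    the kernel of T^* - z, because the Jacobi recurrence determines a solution
    from its first entry.  A unitary U that carries T to T' maps the kernel of
    T^* - z onto that of T'^* - z, so U p(z) = phi(z) p'(z) for a scalar
    phi(z).  The heart of the proof is that phi is constant.

    Taking first entries, phi(z) = (p(z), w) with U w = e_0.  Hence phi is a
    locally uniform limit of polynomials, bounded by the norm of p(z) times
    that of w; and it has no zero, as U is isometric: |phi(z)| is the quotient
    of the norms of p(z) and p'(z).  By a theorem of M. Riesz
    ([orthopoly_minimal_type]) these norms grow more slowly than
    exp(eps |z|) for each eps > 0, and a zero-free function of minimal
    exponential type is constant ([zero_free_minimal_type_const]).

    Now let U w_k = e_k.  The entry of index k of U p(x) = c p'(x) says that
    c P'_k(x) is the sum of the series of the P_n(x) with coefficients the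
    conjugates of w_k(n), for x real.  Such an expansion is unique
    ([orthopoly_series_unique]), so it is the finite expansion of c P'_k in
    P_0, ..., P_k: the matrix of the adjoint of U is triangular.  Its rows are
    orthonormal, hence it is diagonal; since P_0 = P'_0 = 1 and all leading
    coefficients are positive, it is a multiple of the identity
    ([preimage_basis]).  So U is multiplication by c, and T' = U T U^-1 = T.

    Riesz's theorem rests on the existence of two measures.  They have
    different Cauchy transforms at some z0 ([eq_measure_of_cauchy_kernel]).
    For each of them, Bessel's inequality for 1/(x - z0) gives a
    square-summable solution of the recurrence with right-hand side e_0; the
    difference of the two is a nonzero multiple of p(z0)
    ([indeterminate_l2_solutions]).  Variation of constants then expresses
    p(z) by these two solutions, and a Gronwall argument bounds P_n(z) by a
    fixed square-summable sequence times an infinite product of factors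
    1 + |z - z0| h_k with summable h, which has minimal exponential type.

    The theorem on zero-free functions is proved for polynomials, where the
    logarithm of the modulus is a sum over the roots.  The contour integral of
    the Borel-Caratheodory argument becomes a mean over roots of unity with
    weights 1 + Re w^j, which are nonnegative and isolate the linear
    coefficient of the logarithm ([caratheodory_root_sum]). *)

Set Implicit Arguments.
Unset Strict Implicit.
Unset Printing Implicit Defensive.
Import Order.TTheory GRing.Theory Num.Theory numFieldNormedType.Exports.
Import ComplexField.Normc.
Local Open Scope classical_set_scope.
Local Open Scope ring_scope.

(** * The modulus of complex numbers *)

Section Modulus.
Variable R : realType.
Implicit Types z w : R[i].

Lemma normc_ge0 z : 0 <= normc z.
Proof. by case: z => a b; rewrite sqrtr_ge0. Qed.

Lemma normr_normc z : `|z| = (normc z)%:C%C. Proof. by []. Qed.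

Lemma normc_eq0 z : (normc z == 0) = (z == 0).
Proof.
by apply/eqP/eqP => [|->]; [exact: eq0_normc|rewrite normc0].
Qed.

Lemma normc_gt0 z : (0 < normc z) = (z != 0).
Proof. by rewrite lt_neqAle normc_ge0 andbT eq_sym normc_eq0. Qed.

Lemma normcX z n : normc (z ^+ n) = normc z ^+ n.
Proof. by elim: n => [|n IH]; rewrite ?normc1// !exprS normcM IH. Qed.

Lemma sqr_normcE z : normc z ^+ 2 = complex.Re z ^+ 2 + complex.Im z ^+ 2.
Proof. by case: z => a b /=; rewrite sqr_sqrtr ?addr_ge0 ?sqr_ge0. Qed.

Lemma mul_conjc z : z * z^*%C = (normc z ^+ 2)%:C%C.
Proof. by case: z => a b; rewrite sqr_normcE; simpc; congr (_ +i* _)%C; ring. Qed.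

Lemma normcJ z : normc z^*%C = normc z.
Proof. by case: z => a b /=; rewrite sqrrN. Qed.

Lemma normc_real (x : R) : normc x%:C%C = `|x|.
Proof. by rewrite /= expr0n/= addr0 sqrtr_sqr. Qed.

Lemma normcB z w : normc (z - w) = normc (w - z).
Proof. by rewrite -opprB normcN. Qed.

Lemma abs_Re_normc z : `|complex.Re z| <= normc z.
Proof.
by case: z => a b /=; rewrite -sqrtr_sqr ler_sqrt ?addr_ge0 ?sqr_ge0// lerDl sqr_ge0.
Qed.

Lemma abs_Im_normc z : `|complex.Im z| <= normc z.
Proof.
by case: z => a b /=; rewrite -sqrtr_sqr ler_sqrt ?addr_ge0 ?sqr_ge0// lerDr sqr_ge0.
Qed.

Lemma normc_triangle z w : normc z - normc w <= normc (z - w).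
Proof. by rewrite lerBlDr; apply: le_trans (le_normcD _ _); rewrite subrK. Qed.

Lemma normc_sum (I : Type) (r : seq I) (P : pred I) (F : I -> R[i]) :
  normc (\sum_(i <- r | P i) F i) <= \sum_(i <- r | P i) normc (F i).
Proof.
elim/big_rec2: _ => [|i y x _ IH]; first by rewrite normc0.
by rewrite (le_trans (le_normcD _ _))// lerD2l.
Qed.

Lemma normc_prod (I : Type) (r : seq I) (P : pred I) (F : I -> R[i]) :
  normc (\prod_(i <- r | P i) F i) = \prod_(i <- r | P i) normc (F i).
Proof. by elim/big_rec2: _ => [|i y x _ <-]; rewrite ?normc1 ?normcM. Qed.

Lemma ReD z w : complex.Re (z + w) = complex.Re z + complex.Re w.
Proof. by case: z w => [? ?] [? ?]. Qed.

Lemma ReN z : complex.Re (- z) = - complex.Re z.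
Proof. by case: z. Qed.

Lemma Re_sum (I : Type) (r : seq I) (P : pred I) (F : I -> R[i]) :
  complex.Re (\sum_(i <- r | P i) F i) = \sum_(i <- r | P i) complex.Re (F i).
Proof. by elim/big_rec2: _ => [//|i y x _ <-]; rewrite ReD. Qed.

Lemma ReMn z n : complex.Re (z *+ n) = complex.Re z *+ n.
Proof. by elim: n => [//|n IH]; rewrite !mulrS ReD IH. Qed.

Lemma ImD z w : complex.Im (z + w) = complex.Im z + complex.Im w.
Proof. by case: z w => [? ?] [? ?]. Qed.

Lemma Im_sum (I : Type) (r : seq I) (P : pred I) (F : I -> R[i]) :
  complex.Im (\sum_(i <- r | P i) F i) = \sum_(i <- r | P i) complex.Im (F i).
Proof. by elim/big_rec2: _ => [//|i y x _ <-]; rewrite ImD. Qed.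

Lemma ReZ (x : R) z : complex.Re (x%:C%C * z) = x * complex.Re z.
Proof. by case: z => a b /=; rewrite mul0r subr0. Qed.

Lemma ImZ (x : R) z : complex.Im (x%:C%C * z) = x * complex.Im z.
Proof. by case: z => a b /=; rewrite mul0r addr0. Qed.

Lemma conjcM z w : (z * w)^*%C = z^*%C * w^*%C.
Proof. exact: rmorphM. Qed.

Lemma conjcD z w : (z + w)^*%C = z^*%C + w^*%C.
Proof. exact: rmorphD. Qed.

Lemma conjcB z w : (z - w)^*%C = z^*%C - w^*%C.
Proof. exact: rmorphB. Qed.

End Modulus.

(** * A finite measure is determined by its Cauchy transform *)

Section CauchyTransformDeterminesMeasure.
Variable R : realType.

Section FiniteMeasure.
Variable mu : {measure set R -> \bar R}.
Hypothesis mu_fin : (mu setT < +oo)%E.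

Lemma bounded_measurable_integrable (f : R -> R) M : measurable_fun setT f ->
  (forall x, `|f x| <= M) -> mu.-integrable setT (EFin \o f).
Proof.
move=> mf fM; apply: measurable_bounded_integrable => //.
exists M; split; first exact: num_real.
by move=> N MN x _; exact: le_trans (fM x) (ltW MN).
Qed.

Lemma bounded_convergence (f_ : nat -> R -> R) (f : R -> R) M :
  (forall n, measurable_fun setT (f_ n)) ->
  (forall n x, `|f_ n x| <= M) -> (forall x, f_ ^~ x @ \oo --> f x) ->
  (fun n => \int[mu]_x f_ n x) @ \oo --> \int[mu]_x f x.
Proof.
move=> mf_ fM f_f; have mf : measurable_fun setT f.
  by apply: (@measurable_fun_cvg _ _ _ setT f_ f) => // x _; exact: f_f.
have fM' x : `|f x| <= M.
  apply: (@closed_cvg _ _ _ eventually_filter (f_ ^~ x) [set y | `|y| <= M]).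
  - rewrite (_ : [set _ | _] = `[-M, M]%classic); first exact: interval_closed.
    by apply/seteqP; split => y /=; rewrite in_itv/= ler_norml.
  - by apply: nearW => n /=; exact: fM.
  - exact: f_f.
have M0 : 0 <= M by apply: le_trans (fM' 0); rewrite normr_ge0.
have [|||||_ _] := @dominated_convergence _ _ _ mu setT measurableT
  (fun n => EFin \o f_ n) (EFin \o f) (cst M%:E).
- by move=> n; exact/measurable_EFinP.
- exact/measurable_EFinP.
- by apply: aeW => x _; apply/cvg_EFin; [exact: nearW|exact: f_f].
- apply: (bounded_measurable_integrable (f := cst M) (M := M)).
    exact: measurable_cst.
  by move=> x; rewrite /= ger0_norm.
- by apply: aeW => x n _; rewrite lee_fin fM.
have iE : (\int[mu]_x (f x)%:E)%E = (\int[mu]_x f x)%:E.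
  rewrite /Rintegral fineK//; apply: integrable_fin_num => //.
  exact: (bounded_measurable_integrable mf fM').
by rewrite iE => /fine_cvg.
Qed.
End FiniteMeasure.

Section TestFunctions.
Variables mu nu : {measure set R -> \bar R}.
Hypothesis mu_fin : (mu setT < +oo)%E.
Hypothesis mu_nu : mu setT = nu setT.

(** These functions form a vector space closed under bounded pointwise limits:
    the indicators of rays are reached from the Cauchy kernels by such limits. *)
Definition same_integral (f : R -> R) : Prop :=
  [/\ measurable_fun setT f, exists M, forall x, `|f x| <= M &
      \int[mu]_x f x = \int[nu]_x f x].

Let nu_fin : (nu setT < +oo)%E. Proof. by rewrite -mu_nu. Qed.

Lemma same_integral_cst c : same_integral (cst c).
Proof.
split; first exact: measurable_cst; first by exists `|c|.
by rewrite !Rintegral_cst// mu_nu.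
Qed.

Lemma same_integral_linear a b f g : same_integral f -> same_integral g ->
  same_integral (fun x => a * f x + b * g x).
Proof.
move=> [mf [M fM] Ef] [mg [N gN] Eg]; split.
- by apply: measurable_funD; apply: measurable_funM => //; exact: measurable_cst.
- exists (`|a| * M + `|b| * N) => x; rewrite (le_trans (ler_normD _ _))//.
  by rewrite !normrM lerD// ler_wpM2l.
- have i (m : {measure set R -> \bar R}) (mfin : (m setT < +oo)%E) :
      \int[m]_x (a * f x + b * g x) = a * \int[m]_x f x + b * \int[m]_x g x.
    have If := bounded_measurable_integrable mfin mf fM.
    have Ig := bounded_measurable_integrable mfin mg gN.
    rewrite RintegralD//; last 2 first.
    + exact: integrableZl If.
    + exact: integrableZl Ig.
    by rewrite !RintegralZl.
  by rewrite !i// Ef Eg.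
Qed.

Lemma same_integral_lim (f_ : nat -> R -> R) f M : (forall n, same_integral (f_ n)) ->
  (forall n x, `|f_ n x| <= M) -> (forall x, f_ ^~ x @ \oo --> f x) ->
  same_integral f.
Proof.
move=> sf fM f_f; have mf_ n : measurable_fun setT (f_ n) by have [] := sf n.
split.
- by apply: (@measurable_fun_cvg _ _ _ setT f_ f) => // x _; exact: f_f.
- exists M => x.
  apply: (@closed_cvg _ _ _ eventually_filter (f_ ^~ x) [set y | `|y| <= M]).
  + rewrite (_ : [set _ | _] = `[-M, M]%classic); first exact: interval_closed.
    by apply/seteqP; split => y /=; rewrite in_itv/= ler_norml.
  + by apply: nearW => n /=; exact: fM.
  + exact: f_f.
- have h1 := bounded_convergence mu_fin mf_ fM f_f.
  have h2 := bounded_convergence nu_fin mf_ fM f_f.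
  have E : (fun n => \int[mu]_x f_ n x) = (fun n => \int[nu]_x f_ n x).
    by apply/funext => n; have [] := sf n.
  by rewrite -(cvg_lim _ h1)// E (cvg_lim _ h2).
Qed.

(** With s = y ^+ 2, this is the imaginary part of 1 / (x - z) divided by y,
    where z = c + i y. *)
Definition cauchy_kernel (c s x : R) : R := ((x - c) ^+ 2 + s)^-1.

Lemma cauchy_kernel_gt0 c s x : 0 < s -> 0 < cauchy_kernel c s x.
Proof. by move=> s0; rewrite invr_gt0 ltr_wpDl// sqr_ge0. Qed.

Lemma cauchy_kernel_le c s x : 0 < s -> cauchy_kernel c s x <= s^-1.
Proof.
by move=> s0; rewrite lef_pV2 ?posrE ?ltr_wpDl ?sqr_ge0// lerDr sqr_ge0.
Qed.

Hypothesis cauchy_kernel_same : forall c s, 0 < s ->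
  \int[mu]_x cauchy_kernel c s x = \int[nu]_x cauchy_kernel c s x.

Lemma measurable_cauchy_kernel c s : 0 < s -> measurable_fun setT (cauchy_kernel c s).
Proof.
move=> s0; apply: continuous_measurable_fun => x; apply: cvgV.
  by rewrite gt_eqF// ltr_wpDl ?sqr_ge0.
pose p : {poly R} := ('X - c%:P) ^+ 2 + s%:P.
have -> : (fun x => (x - c) ^+ 2 + s) = horner p.
  by apply/funext => y; rewrite /p !hornerE.
have -> : (x - c) ^+ 2 + s = p.[x] by rewrite /p !hornerE.
exact: continuous_horner.
Qed.

(** Partial fractions: with distinct s and t, the product of two kernels is a
    multiple of their difference.  Distinctness matters, and powers of one
    kernel have to be reached as limits of such products. *)
Lemma same_integral_prod_cauchy_kernel c (l : seq R) : uniq l -> all (fun s => 0 < s) l ->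
  same_integral (fun x => \prod_(s <- l) cauchy_kernel c s x).
Proof.
have [n] := ubnP (size l); elim: n l => // n IH [|s [|t l]] ln ul pl.
- have -> : (fun x => \prod_(s <- [::]) cauchy_kernel c s x) = cst 1.
    by apply/funext => x; rewrite big_nil.
  exact: same_integral_cst.
- have -> : (fun x => \prod_(s <- [:: s]) cauchy_kernel c s x) = cauchy_kernel c s.
    by apply/funext => x; rewrite big_seq1.
  have s0 : 0 < s by case/andP: pl.
  split; [exact: measurable_cauchy_kernel| |exact: cauchy_kernel_same].
  by exists s^-1 => x; rewrite ger0_norm ?cauchy_kernel_le// ltW// cauchy_kernel_gt0.
move: ul pl => /= /andP[+ /andP[tl ul]] /and3P[s0 t0 pl].
rewrite inE negb_or => /andP[st sl].
have -> : (fun x => \prod_(r <- [:: s, t & l]) cauchy_kernel c r x) =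
   fun x => (t - s)^-1 * (\prod_(r <- s :: l) cauchy_kernel c r x) +
     (- (t - s)^-1) * (\prod_(r <- t :: l) cauchy_kernel c r x).
  apply/funext => x; rewrite !big_cons /cauchy_kernel; field.
  by rewrite subr_eq0 [t == s]eq_sym st !gt_eqF ?ltr_wpDl ?sqr_ge0.
by apply: same_integral_linear; apply: IH; rewrite ?ltnS//= ?sl ?tl ?s0 ?t0.
Qed.

Lemma same_integral_expr_cauchy_kernel c s n : 0 < s ->
  same_integral (fun x => cauchy_kernel c s x ^+ n).
Proof.
move=> s0.
(* The poles s + i / (m + 1), for i < n, are distinct and tend to s. *)
pose f_ (m : nat) x := \prod_(r <- [seq s + i%:R / m.+1%:R | i <- iota 0 n]) cauchy_kernel c r x.
have prodE (a : R) : \prod_(i <- iota 0 n) a = a ^+ n.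
  by rewrite big_const_seq count_predT size_iota iter_mulr_1.
have pos (m i : nat) : 0 < s + i%:R / m.+1%:R by rewrite ltr_wpDr.
apply: (@same_integral_lim f_ _ (s^-1 ^+ n)).
- move=> m; apply: same_integral_prod_cauchy_kernel; last first.
    by apply/allP => _ /mapP[i _ ->]; exact: (pos m i).
  rewrite map_inj_uniq ?iota_uniq// => i j /addrI /mulIf h.
  by apply/eqP; rewrite -(eqr_nat R); apply/eqP/h; rewrite invr_eq0 pnatr_eq0.
- move=> m x; rewrite /f_ big_map normr_prod -prodE.
  apply: ler_prod => i _; rewrite normr_ge0 ger0_norm ?(ltW (cauchy_kernel_gt0 _ _ (pos _ _)))//.
  apply: le_trans (cauchy_kernel_le _ _ (pos _ _)) _; rewrite lef_pV2 ?posrE ?pos//.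
  by rewrite lerDl.
- move=> x; rewrite -prodE /f_; under eq_fun do rewrite big_map.
  suff H (l : seq nat) :
      (fun m : nat => \prod_(i <- l) cauchy_kernel c (s + i%:R / m.+1%:R) x) @ \oo -->
      \prod_(i <- l) cauchy_kernel c s x by exact: H.
  elim: l => [|i l IH].
    rewrite big_nil; rewrite (_ : (fun _ => _) = cst 1); first exact: cvg_cst.
    by apply/funext => m; rewrite big_nil.
  rewrite big_cons; rewrite (_ : (fun _ => _) = (fun m : nat =>
    cauchy_kernel c (s + i%:R / m.+1%:R) x *
    \prod_(j <- l) cauchy_kernel c (s + j%:R / m.+1%:R) x)); last first.
    by apply/funext => m; rewrite big_cons.
  apply: cvgM => //.
  apply: cvgV; first by rewrite gt_eqF// ltr_wpDl ?sqr_ge0.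
  apply: cvgD; first exact: cvg_cst.
  rewrite -[X in _ --> X]addr0; apply: cvgD; first exact: cvg_cst.
  rewrite -(mulr0 i%:R); apply: cvgMr; exact: cvg_harmonic.
Qed.

Lemma same_integral_horner_cauchy_kernel c s (p : {poly R}) : 0 < s ->
  same_integral (fun x => p.[cauchy_kernel c s x]).
Proof.
move=> s0; have -> : (fun x => p.[cauchy_kernel c s x]) =
    (fun x => \sum_(k < size p) p`_k * cauchy_kernel c s x ^+ k).
  by apply/funext => x; rewrite horner_coef.
elim: (size p) => [|n IH].
  rewrite (_ : (fun _ => _) = cst 0); first exact: same_integral_cst.
  by apply/funext => x; rewrite big_ord0.
rewrite (_ : (fun _ => _) = (fun x => 1 * (\sum_(k < n) p`_k * cauchy_kernel c s x ^+ k) +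
    p`_n * cauchy_kernel c s x ^+ n)).
  by apply: same_integral_linear => //; exact: same_integral_expr_cauchy_kernel.
by apply/funext => x; rewrite big_ord_recr /= mul1r.
Qed.

Lemma bernoulli_ge (u : R) m : 0 <= u <= 1 -> 1 - m%:R * u <= (1 - u) ^+ m.
Proof.
move=> /andP[u0 u1]; elim: m => [|m IH]; first by rewrite mul0r subr0.
rewrite exprS -natr1; apply: (@le_trans _ _ ((1 - u) * (1 - m%:R * u))).
  have := mulr_ge0 (mulr_ge0 (ler0n R m) u0) u0; nra.
by rewrite ler_wpM2l// subr_ge0.
Qed.

Lemma bernoulli_le (u : R) m : 0 <= u <= 1 -> (1 - u) ^+ m * (1 + m%:R * u) <= 1.
Proof.
move=> /andP[u0 u1]; elim: m => [|m IH]; first by rewrite mul0r addr0 mulr1.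
rewrite exprSr -mulrA; apply: le_trans IH; rewrite ler_wpM2l ?exprn_ge0 ?subr_ge0//.
rewrite -natr1; have := mulr_ge0 (mulr_ge0 (ler0n R m) u0) u0; nra.
Qed.

Lemma cvg_natmul_expr (z : R) : 0 <= z -> z < 1 -> (fun n => n%:R * z ^+ n) @ \oo --> 0.
Proof.
move=> z0 z1; pose w := Num.sqrt z.
have w0 : 0 <= w by exact: sqrtr_ge0.
have zw : z = w * w by rewrite -expr2 sqr_sqrtr.
have w1 : w < 1 by rewrite -(ltr_pXn2r (n := 2)) ?nnegrE// expr1n expr2 -zw.
have cw : (fun n => (1 - w)^-1 * w ^+ n) @ \oo --> 0.
  rewrite -(mulr0 (1 - w)^-1); apply: cvgMr; apply: cvg_expr.
  by rewrite ger0_norm.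
apply: (squeeze_cvgr _ (cvg_cst 0) cw); apply: nearW => n.
rewrite mulr_ge0 ?exprn_ge0//= zw exprMn mulrA ler_wpM2r ?exprn_ge0//.
have h : w ^+ n * (1 + n%:R * (1 - w)) <= 1.
  have -> : w = 1 - (1 - w) by rewrite subKr.
  by rewrite {2}subKr; apply: bernoulli_le; rewrite subr_ge0 ltW//= lerBlDl lerDr.
 rewrite -[leRHS]mul1r ler_pdivlMr ?subr_gt0//.
apply: le_trans h; rewrite [leRHS]mulrDr mulr1 [in leRHS]mulrA.
by rewrite [w ^+ n * _]mulrC lerDr exprn_ge0.
Qed.

(** The exponent times y ^+ n is n * (2 y) ^+ n, which tends to 0 below the
    threshold 1/2 and to infinity from it on; without the factor n the limit
    at y = 1/2 would be 1/e. *)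
Lemma cvg_threshold (y : R) : 0 <= y <= 1 ->
  (fun n => (1 - y ^+ n) ^+ (n * 2 ^ n)) @ \oo --> ((y < 2^-1)%R%:R : R).
Proof.
move=> /andP[y0 y1]; have u01 n : 0 <= y ^+ n <= 1 by rewrite exprn_ge0//= exprn_ile1.
have E n : (n * 2 ^ n)%:R * y ^+ n = n%:R * (2 * y) ^+ n.
  by rewrite natrM natrX exprMn mulrA.
have [y2|y2] := ltP y 2^-1.
  have c0 : (fun n => 1 - n%:R * (2 * y) ^+ n) @ \oo --> (1 : R).
    rewrite -[X in _ --> X]subr0; apply: cvgB; first exact: cvg_cst.
    by apply: cvg_natmul_expr; lra.
  rewrite mulr1n; apply: (squeeze_cvgr _ c0 (cvg_cst (1 : R))); apply: nearW => n.
  rewrite -E bernoulli_ge//= exprn_ile1// ?subr_ge0 ?lerBlDr ?lerDl;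
    by case/andP: (u01 n).
rewrite mulr0n; apply: (squeeze_cvgr _ (cvg_cst (0 : R)) (@cvg_harmonic R)); apply: nearW => n.
have v0 : 0 <= (1 - y ^+ n) ^+ (n * 2 ^ n).
  by rewrite exprn_ge0// subr_ge0; case/andP: (u01 n).
rewrite v0 /=; rewrite -[leRHS]mul1r ler_pdivlMr//.
apply: le_trans (bernoulli_le (n * 2 ^ n) (u01 n)); rewrite ler_wpM2l//.
rewrite E -natr1 addrC lerD2l ler_peMr// exprn_ege1//; lra.
Qed.

(** The kernel scaled to have maximum 1 is below 1/2 exactly when x is at
    distance more than r from c, so [cvg_threshold] applies to polynomials in
    the kernel. *)
Lemma same_integral_far c r : 0 < r ->
  same_integral (fun x => (r < `|x - c|)%R%:R).
Proof.
move=> r0; pose s := r ^+ 2; have s0 : 0 < s by rewrite exprn_gt0.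
pose p n : {poly R} := (1 - (s *: 'X) ^+ n) ^+ (n * 2 ^ n).
have y01 x : 0 <= s * cauchy_kernel c s x <= 1.
  rewrite mulr_ge0 ?(ltW s0) ?(ltW (cauchy_kernel_gt0 _ _ s0))//= mulrC.
  by rewrite -ler_pdivlMr// mul1r cauchy_kernel_le.
have pE n x : (p n).[cauchy_kernel c s x] = (1 - (s * cauchy_kernel c s x) ^+ n) ^+ (n * 2 ^ n).
  by rewrite /p !hornerE.
apply: (@same_integral_lim (fun n x => (p n).[cauchy_kernel c s x]) _ 1).
- by move=> n; exact: same_integral_horner_cauchy_kernel.
- move=> n x; rewrite pE; have /andP[h0 h1] := y01 x.
  have u0 : 0 <= (s * cauchy_kernel c s x) ^+ n by exact: exprn_ge0.
  have u1 : (s * cauchy_kernel c s x) ^+ n <= 1 by exact: exprn_ile1.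
  rewrite ger0_norm ?exprn_ge0 ?subr_ge0// exprn_ile1 ?subr_ge0//; lra.
- move=> x; have -> : (r < `|x - c|) = (s * cauchy_kernel c s x < 2^-1).
    have -> : (r < `|x - c|) = (r ^+ 2 < `|x - c| ^+ 2).
      by rewrite ltr_pXn2r ?nnegrE ?normr_ge0 ?(ltW r0).
    have -> : `|x - c| ^+ 2 = (x - c) ^+ 2 by rewrite real_normK ?num_real.
    rewrite -/s /cauchy_kernel ltr_pdivrMr ?ltr_wpDl ?sqr_ge0//; lra.
  by under eq_fun do rewrite pE; exact: cvg_threshold.
Qed.

(** A ray is the increasing union of the closed intervals centred at a + n with
    radius n, whose complements are the sets of [same_integral_far]. *)
Lemma same_integral_ray a : same_integral (\1_(`[a, +oo[%classic)).
Proof.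
pose f_ n x : R := 1 * cst 1 x + (- 1) * (n.+1%:R < `|x - (a + n.+1%:R)|)%R%:R.
have fE n x : f_ n x = ((a <= x) && (x <= a + n.+1%:R *+ 2))%R%:R.
  rewrite /f_ mul1r mulN1r /cst ltNge ler_distl addrK.
  have -> : a + n.+1%:R + n.+1%:R = a + n.+1%:R *+ 2 by rewrite -addrA -mulr2n.
  by case: (_ && _); rewrite ?subr0 ?subrr.
apply: (@same_integral_lim f_ _ 1).
- move=> n; apply: same_integral_linear; first exact: same_integral_cst.
  by apply: same_integral_far.
- by move=> n x; rewrite fE; case: (_ && _); rewrite ?normr1 ?normr0.
- move=> x; rewrite indicE mem_setE in_itv/= andbT; under eq_fun do rewrite fE.
  have [ax|ax] := leP a x; last exact: cvg_cst.
  apply: cvg_near_cst; near=> n; suff -> : x <= a + n.+1%:R *+ 2 by [].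
  have : x - a <= n%:R by near: n; exact: nbhs_infty_ger.
  by rewrite -mulr_natl -natr1; have := ler0n R n; lra.
Unshelve. all: by end_near.
Qed.

(** The rays are stable under intersection and generate the Borel sets, so
    agreement on them ([same_integral_ray]) suffices. *)
Lemma eq_measure_of_cauchy_kernel A : measurable A -> mu A = nu A.
Proof.
have mG : (measurable : set (set R)) = <<s RGenCInfty.G (R := R) >>.
  exact: RGenCInfty.measurableE.
apply: (measure_unique _ (fun n : nat => `[- (n%:R : R), +oo[%classic) mG).
- move=> _ _ [a ->] [b ->]; exists (Num.max a b).
  by apply/seteqP; split => x /=; rewrite !in_itv/= !andbT ge_max => /andP.
- by move=> n; exists (- n%:R).
- apply/seteqP; split => // x _; exists (Num.truncn `|x|).+1 => //=.
  rewrite in_itv/= andbT lerNl; apply: le_trans (ltW (truncnS_gt _)).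
  by rewrite -normrN ler_norm.
- move=> B [a ->]; have [_ _ ] := same_integral_ray a.
  have mI : measurable (`[a, +oo[%classic : set R) by exact: measurable_itv.
  rewrite /Rintegral !integral_indic// !setIT.
  have fin (m : {measure set R -> \bar R}) : (m setT < +oo)%E ->
      m `[a, +oo[%classic \is a fin_num.
    move=> mfin; rewrite ge0_fin_numE//; apply: le_lt_trans mfin.
    by apply: le_measure; rewrite ?inE//.
  move=> E; rewrite -[LHS]fineK ?fin// -[RHS]fineK ?fin//; congr EFin; exact: E.
- move=> k; apply: le_lt_trans mu_fin; apply: le_measure; rewrite ?inE//.
Qed.
End TestFunctions.
End CauchyTransformDeterminesMeasure.

(** * Square-summable solutions of the Jacobi recurrence *)

Section JacobiRecurrence.
Variables (R : realType) (s : nat -> R).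
Implicit Types z w : R[i].

(** The formal action of the Jacobi matrix on an arbitrary sequence. *)
Definition jacobi_apply (x : nat -> R[i]) (n : nat) : R[i] :=
  (jacobi_a s n)%:C%C * x n.+1 + (jacobi_b s n)%:C%C * x n +
  (if n is m.+1 then (jacobi_a s m)%:C%C * x m else 0).

Definition orthopolyC n z : R[i] := (map_poly (real_complex R) (orthopoly s n)).[z].

Hypothesis s_pd : positive_definite s.
Hypothesis s0 : s 0%N = 1.

Lemma orthopolyC0 z : orthopolyC 0 z = 1.
Proof. by rewrite /orthopolyC orthopoly0// rmorph1 hornerC. Qed.

Lemma orthopolyC_real n (x : R) : orthopolyC n x%:C%C = ((orthopoly s n).[x])%:C%C.
Proof. by rewrite /orthopolyC horner_map. Qed.

Lemma jacobi_apply_orthopolyC z n :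
  jacobi_apply (orthopolyC^~ z) n = z * orthopolyC n z.
Proof.
have := three_term_recurrence s_pd n; rewrite /jacobi_apply /orthopolyC.
move: (orthopoly s) => P E.
transitivity (map_poly (real_complex R) ('X * P n)).[z]; last first.
  by rewrite rmorphM/= map_polyX hornerM hornerX.
rewrite E.
rewrite !rmorphD/= !hornerD !map_polyZ !hornerZ; congr (_ + _).
case: n {E} => [|n]; first by rewrite map_poly0 horner0.
by rewrite map_polyZ hornerZ.
Qed.

(** Every jacobi_a s n is nonzero, so the recurrence determines each entry from
    the previous ones. *)
Lemma jacobi_apply_eigen z (d : nat -> R[i]) :
  (forall n, jacobi_apply d n = z * d n) -> forall n, d n = d 0%N * orthopolyC n z.
Proof.
move=> de n; suff : d n = d 0%N * orthopolyC n z /\ d n.+1 = d 0%N * orthopolyC n.+1 z by case.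
have step m : (forall k, (k <= m)%N -> d k = d 0%N * orthopolyC k z) ->
    d m.+1 = d 0%N * orthopolyC m.+1 z.
  move=> dk; have a0 : (jacobi_a s m)%:C%C != 0 :> R[i].
    by rewrite fmorph_eq0 gt_eqF// jacobi_a_gt0.
  apply: (mulfI a0); have := de m; have := jacobi_apply_orthopolyC z m.
  rewrite /jacobi_apply (dk m (leqnn m)).
  case: m a0 dk => [|m] a0 dk.
    rewrite /= !addr0 => h1 h2.
    apply: (addIr ((jacobi_b s 0)%:C%C * (d 0%N * orthopolyC 0 z))).
    by rewrite h2 mulrCA -h1; ring.
  rewrite /= (dk m (leqnSn m)) => h1 h2.
  apply: (addIr ((jacobi_b s m.+1)%:C%C * (d 0%N * orthopolyC m.+1 z) +
     (jacobi_a s m)%:C%C * (d 0%N * orthopolyC m z))).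
  by rewrite addrA h2 mulrCA -h1; ring.
have all_k : forall m k, (k <= m)%N -> d k = d 0%N * orthopolyC k z.
  elim=> [|m IH] k; first by rewrite leqn0 => /eqP ->; rewrite orthopolyC0 mulr1.
  by rewrite leq_eqVlt => /predU1P[->|/IH//]; apply: step.
by split; apply: all_k.
Qed.

End JacobiRecurrence.

Section Bessel.
Variables (R : realType) (s : nat -> R) (mu : {measure set R -> \bar R}).
Hypothesis mu_s : has_moments mu s.
Hypothesis s0 : s 0%N = 1.
Hypothesis s_pd : positive_definite s.
Local Notation P := (orthopoly s).

Lemma mu_setT : mu setT = 1%E.
Proof.
have [_] := mu_s 0; rewrite s0 => <-.
by under eq_integral do rewrite expr0; rewrite integral_cst// mul1e.
Qed.

Let mu_fin : (mu setT < +oo)%E. Proof. by rewrite mu_setT ltry. Qed.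

Lemma integrable_horner (p : {poly R}) : mu.-integrable setT (EFin \o horner p).
Proof.
have -> : EFin \o horner p = fun x => (\sum_(k < size p) (p`_k * x ^+ k)%:E)%E.
  by apply/funext => x /=; rewrite horner_coef sumEFin.
apply: integrable_sum => // k _.
have := integrableZl measurableT p`_k (mu_s k).1.
by apply: eq_integrable.
Qed.

Definition bounded_measurable (f : R -> R) : Prop :=
  measurable_fun setT f /\ exists M, forall x, `|f x| <= M.

Lemma integrable_bounded_horner f p : bounded_measurable f ->
  mu.-integrable setT (EFin \o (fun x => f x * p.[x])).
Proof.
move=> [mf [M fM]]; have := integrableMr measurableT mf _ (integrable_horner p).
apply; exists M; split; first exact: num_real.
by move=> N MN x _; exact: le_trans (fM x) (ltW MN).
Qed.

Definition weighted_integral (f : R -> R) (p : {poly R}) : R :=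
  \int[mu]_x (f x * p.[x]).

Lemma weighted_integral_linear f c p q : bounded_measurable f ->
  weighted_integral f (c *: p + q) = c * weighted_integral f p + weighted_integral f q.
Proof.
move=> bf; rewrite /weighted_integral -RintegralZl//; last exact: integrable_bounded_horner.
rewrite -RintegralD//.
- by apply: eq_Rintegral => x _; rewrite hornerD hornerZ; ring.
- have := integrableZl measurableT c (integrable_bounded_horner p bf).
  by apply: eq_integrable.
- exact: integrable_bounded_horner.
Qed.

Lemma weighted_integral0 f : weighted_integral f 0 = 0.
Proof.
rewrite /weighted_integral (_ : (fun _ => _) = cst 0) ?Rintegral_cst ?mul0r//.
by apply/funext => x; rewrite horner0 mulr0.
Qed.

Lemma weighted_integral_sum f n (c : nat -> R) (p : nat -> {poly R}) :
  bounded_measurable f ->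
  weighted_integral f (\sum_(k < n) c k *: p k) =
  \sum_(k < n) c k * weighted_integral f (p k).
Proof.
move=> bf; elim: n => [|n IH]; first by rewrite !big_ord0 weighted_integral0.
by rewrite !big_ord_recr/= addrC weighted_integral_linear// IH addrC.
Qed.

Lemma bounded_measurable_cst c : bounded_measurable (cst c).
Proof. by split; [exact: measurable_cst|exists `|c|]. Qed.

Lemma integral_hornerM (p q : {poly R}) : \int[mu]_x (p * q).[x] = mdot s p q.
Proof.
have b1 := bounded_measurable_cst 1.
have E r : \int[mu]_x r.[x] = weighted_integral (cst 1) r.
  by apply: eq_Rintegral => x _; rewrite mul1r.
rewrite E -{1}[p]coefK poly_def mulr_suml /mdot.
under eq_bigr do rewrite -scalerAl.
rewrite (weighted_integral_sum _ _ (fun k => 'X^k * q))//.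
apply: eq_bigr => i _; rewrite -{1}[q]coefK poly_def mulr_sumr.
under eq_bigr do rewrite -scalerAr -exprD.
rewrite (weighted_integral_sum _ _ (fun k => 'X^(i + k)))// mulr_sumr.
apply: eq_bigr => j _; rewrite mulrA -E; congr (_ * _); rewrite /Rintegral.
under eq_integral do rewrite hornerXn.
by rewrite (mu_s _).2.
Qed.

(** Expand the integral of the square of f minus its projection on the span of
    P_0, ..., P_(N-1), which is nonnegative. *)
Lemma bessel_inequality f N : bounded_measurable f ->
  \sum_(n < N) weighted_integral f (P n) ^+ 2 <= \int[mu]_x (f x ^+ 2).
Proof.
move=> bf; have [mf [M fM]] := bf.
pose c n := weighted_integral f (P n).
pose g : {poly R} := \sum_(n < N) c n *: P n.
have bf2 : bounded_measurable (fun x => f x ^+ 2).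
  split; first exact: measurable_funX.
  exists (M ^+ 2) => x; rewrite normrX lerXn2r ?nnegrE//.
  exact: le_trans (fM x).
have fg : weighted_integral f g = \sum_(n < N) c n ^+ 2.
  by rewrite (weighted_integral_sum _ c P)//; apply: eq_bigr => n _; rewrite expr2.
have gg : \int[mu]_x (g * g).[x] = \sum_(n < N) c n ^+ 2.
  rewrite integral_hornerM {1}/g mdot_suml; apply: eq_bigr => n _.
  rewrite mdotZl mdotC mdot_suml (bigD1 n)//= mdotZl orthopoly_orthonormal// eqxx.
  rewrite mulr1 big1 ?addr0 ?expr2// => k kn.
  by rewrite mdotZl orthopoly_orthonormal// val_eqE (negbTE kn) mulr0.
have If2 : mu.-integrable setT (EFin \o (fun x => f x ^+ 2)).
  by case: bf2 => mf2 [M2 fM2]; exact: (bounded_measurable_integrable mu_fin mf2 fM2).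
have : 0 <= \int[mu]_x ((f x ^+ 2 + (- 2) * (f x * g.[x])) + (g * g).[x]).
  apply: Rintegral_ge0 => x _; have := sqr_ge0 (f x - g.[x]); rewrite hornerM; lra.
have Ifg : mu.-integrable setT (EFin \o (fun x => - 2 * (f x * g.[x]))).
  have := integrableZl measurableT (- 2) (integrable_bounded_horner g bf).
  by apply: eq_integrable.
rewrite RintegralD//; last 2 first.
- by have := integrableD measurableT If2 Ifg; apply: eq_integrable.
- exact: integrable_horner.
rewrite RintegralD// RintegralZl//; last exact: integrable_bounded_horner.
by rewrite -/(weighted_integral f g) fg gg; lra.
Qed.

(** The solution is the sequence of the integrals of P_n(x) / (x - z) for
    z = t + i y, written with real and imaginary parts: x / (x - z) is
    1 + z / (x - z), and the integral of P_n vanishes unless n = 0.  It is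
    square summable by Bessel's inequality. *)
Lemma l2_solution_of_measure (t y : R) : 0 < y ->
  exists f : nat -> R[i], [/\ square_summable f,
    complex.Im (f 0%N) = y * \int[mu]_x cauchy_kernel t (y ^+ 2) x &
    forall n, jacobi_apply s f n = (t +i* y)%C * f n + (n == 0%N)%:R].
Proof.
move=> y0; have y20 : 0 < y ^+ 2 by rewrite exprn_gt0.
pose K := cauchy_kernel t (y ^+ 2).
have mK : measurable_fun setT K by exact: measurable_cauchy_kernel.
have K0 x : 0 < K x by exact: cauchy_kernel_gt0.
have KE x : K x * ((x - t) ^+ 2 + y ^+ 2) = 1.
  by rewrite mulVf// gt_eqF// ltr_wpDl ?sqr_ge0.
pose g x := (x - t) * K x; pose h x := y * K x.
have bg : bounded_measurable g.
  split.
    apply: measurable_funM => //; apply: measurable_funB => //; exact: measurable_cst.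
  exists y^-1 => x; rewrite normrM (ger0_norm (ltW (K0 x))) mulrC.
  rewrite mulrC ler_pdivrMr ?ltr_wpDl ?sqr_ge0// ler_pdivlMl//.
  have -> : (x - t) ^+ 2 = `|x - t| ^+ 2 by rewrite real_normK ?num_real.
  by have := sqr_ge0 (`|x - t| - y); have := mulr_ge0 (normr_ge0 (x - t)) (ltW y0); nra.
have bh : bounded_measurable h.
  split; first by apply: measurable_funM => //; exact: measurable_cst.
  exists (y * (y ^+ 2)^-1) => x; rewrite normrM !ger0_norm ?(ltW (K0 x)) ?(ltW y0)//.
  by rewrite ler_pM2l// cauchy_kernel_le.
pose G n := weighted_integral g (P n); pose H n := weighted_integral h (P n).
have int1 n : weighted_integral (cst 1) (P n) = (n == 0%N)%:R.
  rewrite -(orthopoly_orthonormal s_pd n 0) orthopoly0// -integral_hornerM mulr1.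
  by apply: eq_Rintegral => x _; rewrite mul1r.
have Ig := integrable_bounded_horner _ bg; have Ih := integrable_bounded_horner _ bh.
have I1 := integrable_bounded_horner _ (bounded_measurable_cst 1).
have Icg c n : mu.-integrable setT (EFin \o (fun x => c * (g x * (P n).[x]))).
  by have := integrableZl measurableT c (Ig (P n)); apply: eq_integrable.
have Ich c n : mu.-integrable setT (EFin \o (fun x => c * (h x * (P n).[x]))).
  by have := integrableZl measurableT c (Ih (P n)); apply: eq_integrable.
have recg n : weighted_integral g ('X * P n) = (n == 0%N)%:R + t * G n - y * H n.
  rewrite -int1 /G /H /weighted_integral -!RintegralZl// -RintegralD// -RintegralB//.
    apply: eq_Rintegral => x _; rewrite hornerM hornerX /= -(KE x) /g /h; ring.
  by have := integrableD measurableT (I1 (P n)) (Icg t n); apply: eq_integrable.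
have rech n : weighted_integral h ('X * P n) = t * H n + y * G n.
  rewrite /G /H /weighted_integral -!RintegralZl// -RintegralD//.
  by apply: eq_Rintegral => x _; rewrite hornerM hornerX /g /h; ring.
have jac f n : bounded_measurable f -> weighted_integral f ('X * P n) =
    jacobi_a s n * weighted_integral f (P n.+1) + jacobi_b s n * weighted_integral f (P n) +
    (if n is m.+1 then jacobi_a s m * weighted_integral f (P m) else 0).
  move=> bf; rewrite three_term_recurrence// -addrA weighted_integral_linear//.
  rewrite weighted_integral_linear// addrA; congr (_ + _).
  case: n => [|n]; first exact: weighted_integral0.
  by rewrite -[_ *: _]addr0 weighted_integral_linear// weighted_integral0 addr0.
exists (fun n => (G n +i* H n)%C); split.
- apply: (@square_summable_bounded _ _ (\int[mu]_x (g x ^+ 2) + \int[mu]_x (h x ^+ 2))).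
  move=> N; rewrite /sqnorm_series /series/= big_mkord.
  apply: le_trans (lerD (bessel_inequality N bg) (bessel_inequality N bh)).
  by rewrite -big_split/=; apply: ler_sum => k _; rewrite sqr_sqrtr ?addr_ge0 ?sqr_ge0.
- rewrite /= /H /weighted_integral orthopoly0//.
  rewrite -RintegralZl//; last first.
    apply: (bounded_measurable_integrable mu_fin mK (M := (y ^+ 2)^-1)) => x.
    by rewrite ger0_norm ?cauchy_kernel_le// ltW.
  by apply: eq_Rintegral => x _; rewrite hornerC mulr1.
- move=> n; have := recg n; have := rech n; rewrite !jac// /jacobi_apply.
  rewrite -/(G n) -/(G n.+1) -/(H n) -/(H n.+1).
  have -> : (n == 0%N)%:R = ((n == 0%N)%:R)%:C%C :> R[i] by rewrite rmorph_nat.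
  case: n => [|n]; rewrite ?addr0 => Eh Eg; apply/eqP; rewrite eq_complex/=;
    apply/andP; split; apply/eqP; rewrite /= in Eg Eh.
  - by rewrite !mul0r !subr0; apply: etrans Eg _; rewrite -addrA addrC.
  - by rewrite !mul0r !addr0.
  - by rewrite !mul0r !subr0; apply: etrans Eg _; rewrite add0r.
  - by rewrite !mul0r !addr0.
Qed.
End Bessel.

Section Indeterminate.
Variables (R : realType) (s : nat -> R).
Hypothesis s_indet : indeterminate_moment_sequence s.

(** The solutions attached to two measures with different Cauchy transforms
    differ by a nonzero solution of the homogeneous recurrence. *)
Lemma indeterminate_l2_solutions : exists z0 : R[i], exists f : nat -> R[i],
  [/\ square_summable (fun n => orthopolyC s n z0), square_summable f &
    forall n, jacobi_apply s f n = z0 * f n + (n == 0%N)%:R].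
Proof.
have [s0 s_pd [mu [nu [mu_s nu_s [A [mA AB]]]]]] := s_indet.
have mu1 := mu_setT mu_s s0; have nu1 := mu_setT nu_s s0.
have [c [r [r0 ne]]] : exists c r, 0 < r /\
    \int[mu]_x cauchy_kernel c r x <> \int[nu]_x cauchy_kernel c r x.
  apply/not_existsP => h; apply: AB; apply: eq_measure_of_cauchy_kernel => //.
  - by rewrite mu1 ltry.
  - by rewrite mu1 nu1.
  - move=> c r r0; apply/not_notP => ne; apply: (h c); exists r; split=> //.
pose y := Num.sqrt r; have y0 : 0 < y by rewrite sqrtr_gt0.
have y2 : y ^+ 2 = r by rewrite sqr_sqrtr// ltW.
have [f [f_l2 f0 f_jac]] := l2_solution_of_measure mu_s s0 s_pd c y0.
have [g [g_l2 g0 g_jac]] := l2_solution_of_measure nu_s s0 s_pd c y0.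
exists (c +i* y)%C, f; split=> //.
pose d := f + (-1) *: g.
have dn n : d n = f n - g n by rewrite /d -[LHS]/(f n + (-1) * g n) mulN1r.
have d0 : d 0%N != 0.
  rewrite dn subr_eq0; apply/eqP => /(congr1 (@complex.Im R)).
  by rewrite f0 g0 y2 => /(mulfI (lt0r_neq0 y0)).
have d_jac n : jacobi_apply s d n = (c +i* y)%C * d n.
  transitivity (jacobi_apply s f n - jacobi_apply s g n); last first.
    by rewrite f_jac g_jac dn; ring.
  by rewrite /jacobi_apply !dn; case: n => [|n]; rewrite ?dn; ring.
have dE : (fun n => orthopolyC s n (c +i* y)%C) = (d 0%N)^-1 *: d.
  apply/funext => n; rewrite -[RHS]/((d 0%N)^-1 * d n).
  by rewrite (jacobi_apply_eigen s_pd s0 d_jac n) mulKf.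
rewrite dE; apply: square_summableZ; apply: square_summableD => //.
exact: square_summableZ.
Qed.
End Indeterminate.

(** * Growth of the orthonormal polynomials *)

Section MinimalType.
Variable R : realType.

(** By induction, the bracket 1 + r * sum is at most the product, since passing
    from n to n.+1 multiplies it by at most 1 + r * m n ^+ 2. *)
Lemma discrete_gronwall (X m : nat -> R) (r : R) : 0 <= r -> (forall n, 0 <= m n) ->
  (forall n, X n <= m n * (1 + r * \sum_(k < n) m k * X k)) ->
  forall n, X n <= m n * \prod_(k < n) (1 + r * m k ^+ 2).
Proof.
move=> r0 m0 Xm; suff S n : 1 + r * \sum_(k < n) m k * X k <= \prod_(k < n) (1 + r * m k ^+ 2).
  by move=> n; rewrite (le_trans (Xm n))// ler_wpM2l.
elim: n => [|n IH]; first by rewrite !big_ord0 mulr0 addr0.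
rewrite !big_ord_recr/=; set S := \sum_(k < n) _ in IH *.
apply: (@le_trans _ _ ((1 + r * S) * (1 + r * m n ^+ 2))); last first.
  by rewrite ler_wpM2r// addr_ge0// mulr_ge0// sqr_ge0.
have : r * (m n * X n) <= r * (m n * (m n * (1 + r * S))).
  by rewrite !ler_wpM2l.
by rewrite expr2; lra.
Qed.

(** The tail of the product is at most the exponential of r times the tail of
    the series, and the finitely many remaining factors grow polynomially. *)
Lemma prod_1D_minimal_type (h : nat -> R) (eps : R) : (forall n, 0 <= h n) ->
  cvgn (series h) -> 0 < eps ->
  exists2 C : R, 0 <= C & forall n r, 0 <= r ->
    \prod_(k < n) (1 + r * h k) <= C * expR (eps * r).
Proof.
move=> h0 ch eps0.
have fin N : forall e : R, 0 < e -> exists2 C : R, 0 <= C & forall r, 0 <= r ->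
    \prod_(k < N) (1 + r * h k) <= C * expR (e * r).
  elim: N => [|N IH] e e0.
    by exists 1 => // r r0; rewrite big_ord0 mul1r -expR0 ler_expR mulr_ge0// ltW.
  have e20 : 0 < e / 2 by rewrite divr_gt0.
  have [C C0 CN] := IH _ e20.
  exists (C * (1 + h N / (e / 2))) => [|r r0].
    by rewrite mulr_ge0// addr_ge0// divr_ge0// ltW.
  rewrite big_ord_recr/=; have -> : e * r = e / 2 * r + e / 2 * r by field.
  rewrite expRD mulrACA; apply: ler_pM.
  - by apply: prodr_ge0 => k _; rewrite addr_ge0// mulr_ge0.
  - by rewrite addr_ge0// mulr_ge0.
  - exact: CN.
  apply: (@le_trans _ _ ((1 + h N / (e / 2)) * (1 + e / 2 * r))); last first.
    by rewrite ler_wpM2l ?expR_ge1Dx// addr_ge0// divr_ge0// ltW.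
  have -> : (1 + h N / (e / 2)) * (1 + e / 2 * r) =
     1 + r * h N + (h N / (e / 2) + e / 2 * r) by field; rewrite gt_eqF.
  by rewrite lerDl addr_ge0 ?divr_ge0 ?mulr_ge0// ltW.
have nd : nondecreasing_seq (series h) by exact: nondecreasing_series.
have e20 : 0 < eps / 2 by rewrite divr_gt0.
have [N hN] : exists N, limn (series h) - eps / 2 <= series h N.
  have /cvgrPdist_le /(_ _ e20)[N _ /(_ N (leqnn N))] := ch.
  by rewrite ler_distl => /andP[_ h1]; exists N; lra.
have tail n : \sum_(N <= k < n) h k <= eps / 2.
  have [nN|nN] := leqP n N; first by rewrite big_geq// ltW.
  have := nondecreasing_cvgn_le nd ch n.
  move: hN; rewrite /series/= (big_cat_nat (n := N) (p := n))//=; last exact: ltnW.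
  lra.
have [C C0 CN] := fin N _ e20.
exists C => // n r r0; have ge1 k : 1 <= 1 + r * h k by rewrite lerDl mulr_ge0.
apply: (@le_trans _ _ (\prod_(k < maxn N n) (1 + r * h k))).
  rewrite -!(big_mkord xpredT (fun k => 1 + r * h k)).
  rewrite [leRHS](big_cat_nat (n := n)) ?leq_maxr//= ler_peMr//.
    by apply: prodr_ge0 => k _; rewrite (le_trans ler01).
  elim/big_rec: _ => // k x _ x1; rewrite -[leLHS]mul1r ler_pM//.
rewrite -(big_mkord xpredT (fun k => 1 + r * h k)).
rewrite (big_cat_nat (n := N)) ?leq_maxl//= big_mkord.
have -> : eps * r = eps / 2 * r + eps / 2 * r by field.
rewrite expRD mulrA; apply: ler_pM.
- by apply: prodr_ge0 => k _; rewrite (le_trans ler01).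
- by apply: prodr_ge0 => k _; rewrite (le_trans ler01).
- exact: CN.
apply: (@le_trans _ _ (expR (r * \sum_(N <= k < maxn N n) h k))); last first.
  by rewrite ler_expR mulrC ler_wpM2r.
rewrite mulr_sumr expR_sum; apply: ler_prod => k _.
by rewrite (le_trans ler01)//= expR_ge1Dx.
Qed.
End MinimalType.

Section Wronskian.
Variables (R : realType) (s : nat -> R).
Implicit Types x y : nat -> R[i].

Definition wronskian x y n : R[i] :=
  (jacobi_a s n)%:C%C * (x n.+1 * y n - x n * y n.+1).

(** Green's formula: the Wronskian of two sequences telescopes. *)
Lemma wronskianE (zx zy : R[i]) (alpha beta : nat -> R[i]) x y :
  (forall n, jacobi_apply s x n = zx * x n + alpha n) ->
  (forall n, jacobi_apply s y n = zy * y n + beta n) ->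
  forall n, wronskian x y n =
    \sum_(k < n.+1) ((zx - zy) * (x k * y k) + (alpha k * y k - beta k * x k)).
Proof.
move=> ex ey; elim=> [|n IH].
  rewrite big_ord1; have := ex 0%N; have := ey 0%N.
  rewrite /jacobi_apply !addr0 /wronskian => hy hx.
  transitivity (((jacobi_a s 0)%:C%C * x 1%N + (jacobi_b s 0)%:C%C * x 0%N) * y 0%N -
     ((jacobi_a s 0)%:C%C * y 1%N + (jacobi_b s 0)%:C%C * y 0%N) * x 0%N); first by ring.
  by rewrite hx hy; ring.
rewrite big_ord_recr/= -IH; have := ex n.+1; have := ey n.+1.
rewrite /jacobi_apply /wronskian => hy hx.
transitivity (wronskian x y n +
  (((jacobi_a s n.+1)%:C%C * x n.+2 + (jacobi_b s n.+1)%:C%C * x n.+1 +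
      (jacobi_a s n)%:C%C * x n) * y n.+1 -
     ((jacobi_a s n.+1)%:C%C * y n.+2 + (jacobi_b s n.+1)%:C%C * y n.+1 +
      (jacobi_a s n)%:C%C * y n) * x n.+1)); first by rewrite /wronskian; ring.
by rewrite hx hy /wronskian; ring.
Qed.

Hypothesis s_pd : positive_definite s.
Hypothesis s0 : s 0%N = 1.

(** By [wronskianE], the Wronskian of P(z0) and f is -1 and those of P(z) with
    P(z0) and with f are sums over k <= n; eliminating P_(n+1)(z) between the
    latter two, the terms k = n cancel. *)
Lemma variation_of_constants (z0 z : R[i]) (f : nat -> R[i]) :
  (forall n, jacobi_apply s f n = z0 * f n + (n == 0%N)%:R) ->
  forall n, orthopolyC s n z = orthopolyC s n z0 - (z - z0) *
    \sum_(k < n) (orthopolyC s n z0 * f k - f n * orthopolyC s k z0) * orthopolyC s k z.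
Proof.
move=> ef n; pose x := orthopolyC s ^~ z; pose p := orthopolyC s ^~ z0.
have ex k : jacobi_apply s x k = z * x k + 0.
  by rewrite addr0 /x jacobi_apply_orthopolyC.
have ep k : jacobi_apply s p k = z0 * p k + 0.
  by rewrite addr0 /p jacobi_apply_orthopolyC.
have del (y : nat -> R[i]) m : \sum_(k < m.+1) (k == 0%N :> nat)%:R * y k = y 0%N.
  by rewrite big_ord_recl/= mul1r big1 ?addr0// => k _; rewrite mul0r.
have x0 : x 0%N = 1 by rewrite /x orthopolyC0.
have p0 : p 0%N = 1 by rewrite /p orthopolyC0.
have Wpf : wronskian p f n = -1.
  rewrite (wronskianE ep ef) -(del (fun=> -1) n) ; apply: eq_bigr => -[[|k] kn] _ /=.
    by rewrite p0; ring.
  by ring.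
have Wxp : wronskian x p n = (z - z0) * \sum_(k < n.+1) x k * p k.
  by rewrite (wronskianE ex ep) mulr_sumr; apply: eq_bigr => k _; ring.
have Wxf : wronskian x f n = (z - z0) * (\sum_(k < n.+1) x k * f k) - 1.
  rewrite (wronskianE ex ef) big_split/= -mulr_sumr; congr (_ + _).
  rewrite -(del (fun=> -1) n) ; apply: eq_bigr => -[[|k] kn] _ /=.
    by rewrite x0; ring.
  by ring.
(* The three-term relation between the Wronskians of three sequences. *)
have key : x n * wronskian p f n = p n * wronskian x f n - f n * wronskian x p n.
  by rewrite /wronskian; ring.
have S : \sum_(k < n) (p n * f k - f n * p k) * x k =
   p n * (\sum_(k < n.+1) x k * f k) - f n * (\sum_(k < n.+1) x k * p k).
  rewrite !big_ord_recr/= !mulrDr !mulr_sumr.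
  rewrite opprD addrACA [p n * (x n * f n)]mulrA [X in _ + X](_ : _ = 0) ?addr0; last by ring.
  by rewrite -sumrB; apply: eq_bigr => k _; ring.
rewrite -/(x n) -/(p n) S; apply: oppr_inj.
by rewrite -mulrN1 -Wpf key Wxf Wxp; ring.
Qed.

End Wronskian.

(** M. Riesz's theorem, in a form uniform in n: the same square-summable
    sequence m serves for all z. *)
Theorem orthopoly_minimal_type (R : realType) (s : nat -> R) :
  indeterminate_moment_sequence s ->
  exists m : nat -> R, [/\ forall n, 0 <= m n, cvgn (series (fun n => m n ^+ 2)) &
    forall eps : R, 0 < eps -> exists2 C : R, 0 <= C &
      forall n z, normc (orthopolyC s n z) <= C * expR (eps * normc z) * m n].
Proof.
move=> hs; have [z0 [f [p_l2 f_l2 ef]]] := indeterminate_l2_solutions hs.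
have [s0 s_pd _] := hs.
pose p n := orthopolyC s n z0; pose m n := normc (p n) + normc (f n).
have m0 n : 0 <= m n by rewrite addr_ge0 ?normc_ge0.
have cm : cvgn (series (fun n => m n ^+ 2)).
  apply: (@series_le_cvg _ _ (fun n => 2 * normc (p n) ^+ 2 + 2 * normc (f n) ^+ 2)).
  - by move=> n; exact: sqr_ge0.
  - by move=> n; rewrite addr_ge0// mulr_ge0 ?sqr_ge0 ?ler0n.
  - by move=> n; have := sqr_ge0 (normc (p n) - normc (f n)); rewrite /m; nra.
  - by apply: is_cvg_seriesD; apply: is_cvg_seriesZ.
exists m; split=> // eps eps0.
have [C C0 CP] := prod_1D_minimal_type (fun n => sqr_ge0 (m n)) cm eps0.
exists (C * expR (eps * normc z0)); first by rewrite mulr_ge0 ?expR_ge0.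
move=> n z; pose r := normc (z - z0).
have r0 : 0 <= r by exact: normc_ge0.
have step k : normc (orthopolyC s k z) <=
    m k * (1 + r * \sum_(i < k) m i * normc (orthopolyC s i z)).
  rewrite (variation_of_constants s_pd s0 z ef).
  apply: le_trans (le_normcD _ _) _; rewrite normcN normcM mulrDr mulr1 -/r.
  apply: lerD; first by rewrite /m lerDl normc_ge0.
  rewrite mulrCA ler_wpM2l//; apply: le_trans (normc_sum _ _ _) _.
  rewrite mulr_sumr; apply: ler_sum => i _; rewrite normcM mulrA.
  rewrite ler_wpM2r ?normc_ge0//; apply: le_trans (le_normcD _ _) _.
  rewrite normcN !normcM -/(p k) -/(p i) /m mulrDr !mulrDl.
  have := normc_ge0 (p k); have := normc_ge0 (f k); have := normc_ge0 (p i).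
  have := normc_ge0 (f i); nra.
apply: le_trans (discrete_gronwall r0 m0 step n) _.
rewrite mulrC ler_wpM2r//; apply: le_trans (CP n r r0) _.
rewrite -mulrA -expRD ler_wpM2l// ler_expR -mulrDr ler_pM2l//.
by rewrite addrC -(normcN z0); exact: le_normcD.
Qed.

(** * Uniqueness of expansions in orthonormal polynomials *)

Section ExpansionUnique.
Variables (R : realType) (s : nat -> R) (mu : {measure set R -> \bar R}).
Hypothesis mu_s : has_moments mu s.
Hypothesis s0 : s 0%N = 1.
Hypothesis s_pd : positive_definite s.
Local Notation P := (orthopoly s).

(** Let F_N be the partial sums and S_N the partial sums of the squares.  As
    F_N tends to 0 pointwise, Fatou's lemma bounds the integral of F_M^2, that
    is S_M, by the limit of the integrals of (F_N - F_M)^2, that is S - S_M.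
    Letting M tend to infinity gives S <= 0. *)
Lemma orthopoly_series_unique (y : nat -> R) :
  cvgn (series (fun n => y n ^+ 2)) ->
  (forall x, (fun N => \sum_(n < N) y n * (P n).[x]) @ \oo --> (0 : R)) ->
  forall n, y n = 0.
Proof.
move=> cy y_0; pose F N : {poly R} := \sum_(n < N) y n *: P n.
pose S N := series (fun n => y n ^+ 2) N.
have FF M N : (M <= N)%N -> mdot s (F N) (F M) = S M.
  move=> MN; rewrite mdotC /S /series/= big_mkord {1}/F mdot_suml; apply: eq_bigr => i _.
  rewrite mdotZl mdotC mdot_suml (bigD1 (widen_ord MN i))//= mdotZl.
  rewrite orthopoly_orthonormal// eqxx mulr1 big1 ?addr0 ?expr2// => k ki.
  rewrite mdotZl orthopoly_orthonormal// -[_ == _]/(k == widen_ord MN i) (negbTE ki).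
  by rewrite mulr0.
have F2 M N : (M <= N)%N -> (\int[mu]_x ((F N - F M).[x] ^+ 2)%:E = (S N - S M)%:E)%E.
  move=> MN; have -> : S N - S M = \int[mu]_x ((F N - F M) * (F N - F M)).[x].
    rewrite (integral_hornerM mu_s) mdotBl ![mdot s _ (F N - F M)]mdotC !mdotBl.
    by rewrite [mdot s (F M) (F N)]mdotC !FF// subrr subr0.
  rewrite /Rintegral fineK; last first.
    exact: integrable_fin_num (integrable_horner mu_s _).
  by apply: eq_integral => x _; rewrite hornerM expr2.
have F0 M : (\int[mu]_x ((F M).[x] ^+ 2)%:E = (S M)%:E)%E.
  have := F2 0%N M (leq0n M).
  have -> : F 0%N = 0 by rewrite /F big_ord0.
  have -> : S 0%N = 0 by rewrite /S /series/= big_geq.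
  by rewrite !subr0.
have half M : S M <= limn S - S M.
  rewrite -lee_fin -F0.
  pose f N x := ((F N - F M).[x] ^+ 2)%:E.
  have f0 N x : [set: R] x -> (0 <= f N x)%E by rewrite lee_fin sqr_ge0.
  have mf N : measurable_fun setT (f N).
    apply/measurable_EFinP; apply: (@measurable_funX _ _ _ _ (horner (F N - F M))).
    by apply: continuous_measurable_fun; exact: continuous_horner.
  have := fatou mu measurableT mf f0.
  have -> : (\int[mu]_x limn_einf (f^~ x))%E = (\int[mu]_x ((F M).[x] ^+ 2)%:E)%E.
    apply: eq_integral => x _.
    have cf : f^~ x @ \oo --> ((F M).[x] ^+ 2)%:E.
      apply/cvg_EFin; first exact: nearW.
      have FN : (fun N => (F N).[x]) @ \oo --> (0 : R).
        rewrite (_ : (fun _ => _) = (fun N => \sum_(n < N) y n * (P n).[x])) //.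
        by apply/funext => N; rewrite horner_sum; apply: eq_bigr => n _; rewrite hornerZ.
      have -> : (F M).[x] ^+ 2 = (0 - (F M).[x]) ^+ 2 by rewrite sub0r sqrrN.
      rewrite (_ : _ \o _ = (fun N => ((F N).[x] - (F M).[x]) ^+ 2)); last first.
        by apply/funext => N /=; rewrite hornerD hornerN.
      rewrite !expr2 (_ : (fun _ => _) =
        (fun N => ((F N).[x] - (F M).[x]) * ((F N).[x] - (F M).[x]))); last first.
        by apply/funext => N; rewrite expr2.
      by apply: cvgM; apply: cvgB => //; exact: cvg_cst.
    by rewrite (cvg_limn_einf_sup cf).1.
  move=> /le_trans; apply.
  have cS : (fun N => (\int[mu]_x f N x)%E) @ \oo --> (limn S - S M)%:E.
    apply: cvg_trans (_ : (fun N => (S N - S M)%:E) @ \oo --> _).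
      apply: near_eq_cvg; near=> N; rewrite /f F2//.
      by near: N; exact: nbhs_infty_ge.
    apply/cvg_EFin; first exact: nearW.
    by apply: cvgB; [exact: cy|exact: cvg_cst].
  by rewrite (cvg_limn_einf_sup cS).1.
have S2 : limn S <= limn S - limn S.
  have -> : limn S - limn S = limn (fun M => limn S - S M).
    by apply/esym/cvg_lim => //; apply: cvgB; [exact: cvg_cst|exact: cy].
  apply: ler_lim => //; last exact: nearW.
  by apply: is_cvgB => //; exact: is_cvg_cst.
move=> n; apply/eqP; rewrite -sqrf_eq0 eq_le sqr_ge0 andbT.
apply: (@le_trans _ _ (S n.+1)).
  rewrite /S seriesSr lerDr; apply: sumr_ge0 => k _; exact: sqr_ge0.
apply: (@le_trans _ _ (limn S)); last by rewrite subrr in S2.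
apply: nondecreasing_cvgn_le => //; apply: nondecreasing_series => k _ _.
exact: sqr_ge0.
Unshelve. all: by end_near.
Qed.
End ExpansionUnique.

(** * Zero-free functions of minimal exponential type *)

Section LogModulus.
Variable R : realType.
Implicit Types y z u w : R[i].

(** The Taylor expansion of ln |1 - y| with a remainder, from the mean value
    theorem for t in [0, 1] applied to t |-> ln |1 - t y|. *)
Lemma ln_normc_1B_ge y K : normc y < 1 ->
  - \sum_(k < K) complex.Re (y ^+ k.+1) / k.+1%:R
    - normc y ^+ K.+1 / (1 - normc y) <= ln (normc (1 - y)).
Proof.
move=> y1.
pose a := complex.Re y; pose b := complex.Im y.
pose N (t : R) := (1 - t * a) ^+ 2 + (t * b) ^+ 2.
have yab : y = (a +i* b)%C by rewrite /a /b; case: (y).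
have NE t : N t = normc (1 - t%:C%C * y) ^+ 2.
  by rewrite sqr_normcE yab /N /=; ring.
have low t : 0 <= t -> t <= 1 -> 1 - normc y <= normc (1 - t%:C%C * y).
  move=> t0 t1; apply: le_trans (normc_triangle _ _).
  rewrite normc1 lerD2l lerN2 normcM normc_real ger0_norm// ler_piMl//.
  exact: normc_ge0.
have N_gt0 t : 0 <= t -> t <= 1 -> 0 < N t.
  move=> t0 t1; rewrite NE exprn_gt0//.
  by apply: lt_le_trans (low t t0 t1); rewrite subr_gt0.
pose S : {poly R} := \sum_(k < K) (complex.Re (y ^+ k.+1) / k.+1%:R) *: 'X^(k.+1).
pose g (t : R) := 2^-1 * ln (N t) + S.[t].
(* N t is the square of |1 - t y|, and dN its derivative. *)
pose dN (t : R) := - (2 * a * (1 - t * a)) + 2 * b * (t * b).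
pose dg (t : R) := 2^-1 * (dN t / N t) + (S^`()).[t].
have derN (t : R) : is_derive t 1 N (dN t).
  have -> : N = horner ((1 - a *: 'X) ^+ 2 + (b *: 'X) ^+ 2).
    by apply/funext => x; rewrite /N !hornerE; ring.
  have -> : dN t = ((1 - a *: 'X) ^+ 2 + (b *: 'X) ^+ 2 : {poly R})^`().[t].
    by rewrite /dN !expr2 !poly.derivE !hornerE /=; ring.
  exact: is_derive_poly.
have derg (t : R) : 0 <= t -> t <= 1 -> is_derive t 1 g (dg t).
  move=> t0 t1; rewrite /g /dg.
  have d1 : is_derive t 1 (fun t => ln (N t)) (dN t / N t).
    have dl := is_derive1_ln (N_gt0 t t0 t1).
    have := is_derive1_comp dl (derN t).
    by rewrite mulrC.
  have d2 : is_derive t 1 (fun t => S.[t]) (S^`()).[t] by exact: is_derive_poly.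
  have := is_deriveD (is_deriveZ 2^-1 d1) d2.
  by [].
have gcont : {within `[0, 1], continuous g}.
  apply: derivable_within_continuous => t; rewrite in_itv/= => /andP[t0 t1].
  by have [] := derg t t0 t1.
have [t|t] := @MVT_segment R g dg 0 1 ler01 _ gcont.
  by rewrite in_itv/= => /andP[/ltW t0 /ltW t1]; exact: derg.
rewrite in_itv/= => /andP[t0 t1]; rewrite subr0 mulr1.
have g0 : g 0 = 0.
  rewrite /g /N !mul0r subr0 expr1n expr0n/= addr0 ln1 mulr0 add0r /S horner_sum.
  by rewrite big1// => k _; rewrite !hornerE expr0n mulr0.
have g1 : g 1 = ln (normc (1 - y)) + \sum_(k < K) complex.Re (y ^+ k.+1) / k.+1%:R.
  rewrite /g NE mul1r lnXn; last first.
    by apply: lt_le_trans (normc_triangle _ _); rewrite normc1 subr_gt0.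
  rewrite -[ln _ *+ 2]mulr_natl mulrA mulVf// mul1r; congr (_ + _).
  rewrite /S horner_sum; apply: eq_bigr => k _.
  by rewrite !hornerE expr1n mulr1.
have S' : (S^`()).[t] = \sum_(k < K) t ^+ k * complex.Re (y ^+ k.+1).
  rewrite /S raddf_sum horner_sum; apply: eq_bigr => k _ /=.
  rewrite derivZ derivXn hornerZ hornerMn hornerXn -[_ ^+ _ *+ _]mulr_natl mulrA.
  by rewrite divfK ?pnatr_eq0// mulrC.
have yt1 : 1 - t%:C%C * y != 0.
  by rewrite -normc_gt0; apply: lt_le_trans (low t t0 t1); rewrite subr_gt0.
have dgE : dg t = complex.Re (- (y * (t%:C%C * y) ^+ K) / (1 - t%:C%C * y)).
  have -> : - (y * (t%:C%C * y) ^+ K) / (1 - t%:C%C * y) =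
      - y / (1 - t%:C%C * y) + \sum_(k < K) (t ^+ k)%:C%C * y ^+ k.+1.
    apply: (mulIf yt1); rewrite mulrDl !divfK//.
    elim: K {S g dg derg gcont g0 g1 S'} => [|K IH].
      by rewrite big_ord0 mul0r addr0 expr0 mulr1.
    rewrite big_ord_recr /= mulrDl addrA -IH rmorphXn !exprMn !exprS; ring.
  rewrite ReD Re_sum /dg S'; congr (_ + _); last first.
    by apply: eq_bigr => k _; rewrite ReZ.
  have -> : (1 - t%:C%C * y)^-1 = (N t)^-1%:C%C * (1 - t%:C%C * y)^*%C.
    apply: (mulfI yt1); rewrite divff// mulrCA mul_conjc NE -rmorphM/= mulVf//.
    by rewrite -NE gt_eqF// N_gt0.
  rewrite [- y * _]mulrCA ReZ mulrA [RHS]mulrC; congr (_ / _).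
  by rewrite /dN yab /=; field.
move=> H.
have : - dg t <= normc y ^+ K.+1 / (1 - normc y).
  apply: le_trans (ler_norm _) _; rewrite normrN dgE.
  apply: le_trans (abs_Re_normc _) _.
  rewrite normcM normcV normcN normcM normcX normcM normc_real ger0_norm//.
  rewrite exprS ler_pM ?mulr_ge0 ?exprn_ge0 ?mulr_ge0 ?invr_ge0 ?normc_ge0//.
    rewrite ler_wpM2l ?normc_ge0// lerXn2r ?nnegrE ?mulr_ge0 ?normc_ge0//.
    by rewrite ler_piMl ?normc_ge0.
  rewrite lef_pV2 ?posrE ?subr_gt0// ?low//.
  by apply: lt_le_trans (low t t0 t1); rewrite subr_gt0.
move: H; rewrite g0 g1; lra.
Qed.

End LogModulus.

Section BorelCaratheodory.
Variable R : realType.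
Implicit Types y z u w : R[i].

Lemma complex_prim_root_exists n : (0 < n)%N ->
  exists w : R[i], n.-primitive_root w.
Proof.
move=> n_gt0; pose p : {poly R[i]} := 'X^n - 1.
have [r Dp] := closed_field_poly_normal p.
rewrite (monicP _) ?monicXnsubC // scale1r in Dp.
have rn1 : all n.-unity_root r by apply/allP=> z; rewrite -root_prod_XsubC -Dp.
have sz_r : (n < (size r).+1)%N.
  by rewrite -(size_prod_XsubC r id) -Dp size_XnsubC.
have [|z _ zP] := hasP (has_prim_root n_gt0 rn1 _ sz_r); last by exists z.
by rewrite -separable_prod_XsubC -Dp separable_Xn_sub_1 // pnatr_eq0 -lt0n.
Qed.

Lemma normc_prim_root n w : (0 < n)%N -> n.-primitive_root w -> normc w = 1.
Proof.
move=> n0 /prim_expr_order wn; apply/eqP.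
by rewrite -(pexpr_eq1 n0) ?normc_ge0// -normcX wn normc1.
Qed.

Lemma sum_expr_prim_root n w m : n.-primitive_root w -> ~~ (n %| m)%N ->
  \sum_(j < n) w ^+ (j * m) = 0.
Proof.
move=> pw nm; have wm1 : w ^+ m - 1 != 0.
  by rewrite subr_eq0 -(prim_order_dvd pw).
apply: (mulfI wm1); rewrite mulr0.
under eq_bigr do rewrite mulnC exprM.
by rewrite -subrX1 -exprM mulnC exprM (prim_expr_order pw) expr1n subrr.
Qed.

Lemma prim_root_weight_ge0 n w j : (0 < n)%N -> n.-primitive_root w ->
  0 <= 1 + complex.Re (w ^+ j).
Proof.
move=> n0 pw; have := abs_Re_normc (w ^+ j).
by rewrite normcX (normc_prim_root n0 pw) expr1n ler_norml => /andP[]; lra.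
Qed.

Lemma sum_prim_root_weight n w : (1 < n)%N -> n.-primitive_root w ->
  \sum_(j < n) (1 + complex.Re (w ^+ j)) = n%:R.
Proof.
move=> n1 pw; rewrite big_split/= sumr_const card_ord -Re_sum.
under [X in complex.Re X]eq_bigr do rewrite -[nat_of_ord _]muln1.
by rewrite (sum_expr_prim_root pw) ?addr0// gtnNdvd.
Qed.

(** The weight is 1 + (w^j + w^-j) / 2; with w^-j written as w^(j (n-1)), each
    term is a full sum of powers, which vanishes unless n divides the exponent. *)
Lemma sum_weighted_expr_prim_root n w k : n.-primitive_root w ->
  (0 < k)%N -> (k.+1 < n)%N ->
  \sum_(j < n) (1 + complex.Re (w ^+ j))%:C%C * w ^+ (j * k) =
  (k == 1%N)%:R * (n%:R / 2).
Proof.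
move=> pw k0 kn; have n0 : (0 < n)%N by exact: leq_trans kn.
have w1 : w * w^*%C = 1.
  by rewrite mul_conjc (normc_prim_root n0 pw) expr1n.
have conjw j : (w ^+ j)^*%C = w ^+ (j * n.-1).
  have wj : w ^+ j != 0.
    rewrite expf_eq0; apply/negP => /andP[_ /eqP w0]; move: w1.
    by rewrite w0 mul0r => /eqP; rewrite eq_sym oner_eq0.
  apply: (mulfI wj); rewrite -exprD -mulnS prednK// mulnC exprM.
  rewrite (prim_expr_order pw) expr1n mul_conjc normcX (normc_prim_root n0 pw).
  by rewrite !expr1n.
have E (j : nat) : (1 + complex.Re (w ^+ j))%:C%C * w ^+ (j * k) =
    w ^+ (j * k) + 2^-1 * (w ^+ (j * k.+1) + w ^+ (j * (n.-1 + k))).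
  rewrite rmorphD/= mulrDl mul1r ReJ_add conjw; congr (_ + _).
  by rewrite mulrAC mulrC mulrDl -!exprD -mulnS -mulnDr.
under eq_bigr do rewrite E.
rewrite big_split/= -mulr_sumr big_split/=.
rewrite (sum_expr_prim_root pw) ?gtnNdvd ?(ltn_trans _ kn)// add0r.
rewrite (sum_expr_prim_root pw (m := k.+1)) ?gtnNdvd// add0r.
case: eqP => [->|k1]; rewrite ?mul1r ?mul0r.
  rewrite addn1 prednK// (eq_bigr (fun=> 1)) ?sumr_const ?card_ord 1?mulrC//.
  by move=> j _; rewrite mulnC exprM (prim_expr_order pw) expr1n.
rewrite (sum_expr_prim_root pw) ?mulr0//.
rewrite -(prednK k0) addnS -addSn prednK// dvdn_addr//.
by rewrite gtnNdvd//; lia.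
Qed.

(** In the expansion of the logarithm to order K only the linear term survives
    the weighted mean, because all other exponents k satisfy 1 < k and
    k + 1 < n. *)
Lemma weighted_mean_ln_normc_ge y w n K : normc y < 1 -> (0 < K)%N -> n = K.+2 ->
  n.-primitive_root w ->
  n%:R * (- complex.Re y / 2 - normc y ^+ K.+1 / (1 - normc y)) <=
  \sum_(j < n) (1 + complex.Re (w ^+ j)) * ln (normc (1 - y * w ^+ j)).
Proof.
move=> y1 K0 nK pw; have n0 : (0 < n)%N by rewrite nK.
set E := _ / (1 - _).
have wj1 j : normc (w ^+ j) = 1 by rewrite normcX (normc_prim_root n0 pw) expr1n.
have W0 (j : nat) : 0 <= 1 + complex.Re (w ^+ j) by exact: prim_root_weight_ge0 pw.
have WS : \sum_(j < n) (1 + complex.Re (w ^+ j)) = n%:R.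
  by apply: sum_prim_root_weight => //; rewrite nK.
pose F (j : nat) := - \sum_(k < K) complex.Re ((y * w ^+ j) ^+ k.+1) / k.+1%:R - E.
apply: (@le_trans _ _ (\sum_(j < n) (1 + complex.Re (w ^+ j)) * F j)); last first.
  apply: ler_sum => j _; apply: ler_wpM2l => //.
  have := @ln_normc_1B_ge R (y * w ^+ j) K.
  by rewrite normcM wj1 mulr1; apply.
rewrite le_eqVlt; apply/orP; left; apply/eqP; rewrite /F.
under [RHS]eq_bigr do rewrite mulrBr mulrN mulr_sumr.
rewrite big_split/= !sumrN -mulr_suml WS mulrBr; congr (_ - _).
rewrite exchange_big/= mulNr mulrN; congr (- _).
transitivity (\sum_(k < K) complex.Re (y ^+ k.+1 *
    \sum_(j < n) (1 + complex.Re (w ^+ j))%:C%C * w ^+ (j * k.+1)) / k.+1%:R).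
  case: K K0 nK {F E} => // K _ nK; rewrite big_ord_recl [X in _ + X]big1 ?addr0.
    rewrite (sum_weighted_expr_prim_root pw) ?nK//= mul1r expr1 divr1.
    have -> : K.+3%:R / 2 = (K.+3%:R / 2)%:C%C :> R[i].
      by rewrite rmorphM/= fmorphV !rmorph_nat.
    by rewrite [y * _]mulrC ReZ; ring.
  move=> k _; rewrite (sum_weighted_expr_prim_root pw) ?nK ?ltnS// /bump/=.
    by rewrite mul0r mulr0 mul0r.
  by rewrite ltn_ord.
apply: eq_bigr => k _; rewrite mulr_sumr Re_sum mulr_suml; apply: eq_bigr => j _.
by rewrite mulrCA ReZ exprMn -exprM mulrA.
Qed.

(** The sum over us is minus the linear coefficient of the logarithm of
    q(z) = prod (1 - u z), and the bound says that ln |q| <= A on the disk of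
    radius r forces that coefficient to be at most 2 A / r.  Compare the
    weighted means of both sides over the points a w^j, where |a| = r, and let
    the order of w tend to infinity. *)
Lemma caratheodory_root_sum (us : seq R[i]) (r rho A : R) :
  0 < r -> rho < 1 -> {in us, forall u, normc u * r <= rho} ->
  (forall z, normc z <= r -> \sum_(u <- us) ln (normc (1 - u * z)) <= A) ->
  normc (\sum_(u <- us) u) * r <= 2 * A.
Proof.
move=> r0 rho1 us_rho usA.
have [us0|us_neq0] := eqVneq us [::].
  rewrite us0 big_nil normc0 mul0r; have := usA 0.
  rewrite us0 big_nil normc0 => /(_ (ltW r0)); lra.
have rho0 : 0 <= rho.
  case: us us_neq0 us_rho {usA} => // u us _ /(_ u (mem_head _ _)).
  by apply: le_trans; rewrite mulr_ge0 ?normc_ge0// ltW.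
suff key a : normc a = r -> - complex.Re (a * \sum_(u <- us) u) / 2 <= A.
  have [S0|S0] := eqVneq (\sum_(u <- us) u) 0.
    have := key r%:C%C; rewrite normc_real gtr0_norm// S0 mulr0 normc0/=.
    by rewrite mul0r => /(_ erefl); lra.
  set S := \sum_(u <- us) u in S0 key *.
  have nS : 0 < normc S by rewrite normc_gt0.
  (* The direction in which - a S is positive real. *)
  have := key (- (r / normc S)%:C%C * S^*%C).
  rewrite normcM normcN normc_real normcJ ger0_norm ?divr_ge0 ?(ltW nS) ?(ltW r0)//.
  rewrite divfK ?gt_eqF// => /(_ erefl).
  rewrite -mulrA [S^*%C * _]mulrC mul_conjc [- _%:C%C * _]mulNr ReN ReZ /= opprK.
  rewrite expr2 mulrA divfK ?gt_eqF//; lra.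
move=> ar.
have fin (K : nat) : - complex.Re (a * \sum_(u <- us) u) / 2 <=
    A + (size us)%:R / (1 - rho) * rho ^+ K.+2.
  pose n := K.+3; have [w pw] := @complex_prim_root_exists n isT.
  have n0 : 0 < n%:R :> R by rewrite ltr0n.
  have wj1 j : normc (w ^+ j) = 1 by rewrite normcX (normc_prim_root _ pw)// expr1n.
  have W0 (j : nat) : 0 <= 1 + complex.Re (w ^+ j) by exact: prim_root_weight_ge0 pw.
  have up : \sum_(j < n) (1 + complex.Re (w ^+ j)) *
      (\sum_(u <- us) ln (normc (1 - u * a * w ^+ j))) <= n%:R * A.
    apply: (@le_trans _ _ (\sum_(j < n) (1 + complex.Re (w ^+ j)) * A)).
      apply: ler_sum => j _; apply: ler_wpM2l => //.
      under eq_bigr do rewrite -mulrA.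
      by apply: usA; rewrite normcM wj1 mulr1 ar.
    by rewrite -mulr_suml sum_prim_root_weight.
  have lo : n%:R * (\sum_(u <- us) (- complex.Re (u * a) / 2 - rho ^+ K.+2 / (1 - rho)))
      <= \sum_(j < n) (1 + complex.Re (w ^+ j)) *
      (\sum_(u <- us) ln (normc (1 - u * a * w ^+ j))).
    under [leRHS]eq_bigr do rewrite mulr_sumr.
    rewrite exchange_big/= mulr_sumr big_seq [leRHS]big_seq.
    apply: ler_sum => u uus.
    have nu : normc (u * a) <= rho by rewrite normcM ar us_rho.
    apply: le_trans (@weighted_mean_ln_normc_ge _ w n K.+1 (le_lt_trans nu rho1) _ _ pw) => //.
    rewrite ler_wpM2l ?(ltW n0)// lerD2l lerN2.
    have nu1 := le_lt_trans nu rho1.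
    apply: ler_pM; rewrite ?exprn_ge0 ?normc_ge0// ?invr_ge0 ?subr_ge0 ?(ltW nu1)//.
      by rewrite lerXn2r ?nnegrE ?normc_ge0.
    by rewrite lef_pV2 ?posrE ?subr_gt0// lerD2l lerN2.
  have := le_trans lo up; rewrite ler_pM2l// big_split/= sumrN big_const_seq.
  rewrite count_predT iter_addr addr0.
  have -> : \sum_(i <- us) - complex.Re (i * a) / 2 =
      - complex.Re (a * \sum_(u <- us) u) / 2.
    rewrite mulr_sumr Re_sum -sumrN mulr_suml; apply: eq_bigr => u _.
    by rewrite [u * a]mulrC.
  by rewrite -[_ *+ size us]mulr_natl lerBlDr; congr (_ <= _ + _); ring.
have cv : (fun K => A + (size us)%:R / (1 - rho) * rho ^+ K.+2) @ \oo --> A.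
  have -> : (fun K => A + (size us)%:R / (1 - rho) * rho ^+ K.+2) =
      (fun K => A + (size us)%:R / (1 - rho) * rho ^+ 2 * rho ^+ K).
    by apply/funext => K; rewrite -[in RHS]mulrA -exprD.
  rewrite -[X in _ --> X]addr0.
  rewrite -[X in _ --> _ + X](mulr0 ((size us)%:R / (1 - rho) * rho ^+ 2)).
  apply: cvgD; first exact: cvg_cst.
  by apply: cvgMr; apply: cvg_expr; rewrite ger0_norm.
rewrite -(cvg_lim _ cv)//; apply: limr_ge; first by apply/cvg_ex; exists A.
by apply: nearW.
Qed.
End BorelCaratheodory.

Section Liouville.
Variable R : realType.
Implicit Types y z u w : R[i].

Lemma horner_deriv_prod_XsubC (rs : seq R[i]) z : all (fun x => z != x) rs ->
  ((\prod_(x <- rs) ('X - x%:P))^`()).[z] =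
  (\prod_(x <- rs) ('X - x%:P)).[z] * \sum_(x <- rs) (z - x)^-1.
Proof.
elim: rs => [_|x rs IH /= /andP[zx zrs]].
  by rewrite !big_nil derivC horner0 mulr0.
rewrite !big_cons derivM derivXsubC mul1r hornerD !hornerM IH// hornerXsubC.
by field; rewrite subr_eq0.
Qed.

(** Factor q over its roots, which all lie outside the disk, so that
    [caratheodory_root_sum] applies to the quotient q(z0 + z) / q(z0). *)
Lemma deriv_le_of_zero_free (q : {poly R[i]}) z0 (r M : R) : 0 < r ->
  (forall z, normc (z - z0) <= r -> q.[z] != 0 /\ normc q.[z] <= M) ->
  normc q^`().[z0] * r <= 2 * normc q.[z0] * ln (M / normc q.[z0]).
Proof.
move=> r0 qM; have [rs] := closed_field_poly_normal q.
set l := lead_coef q; set p := \prod_(x <- rs) _ => qE.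
have [qz0 _] : q.[z0] != 0 /\ normc q.[z0] <= M.
  by apply: qM; rewrite subrr normc0 ltW.
have nq0 : 0 < normc q.[z0] by rewrite normc_gt0.
have rs_far : {in rs, forall x, r < normc (x - z0)}.
  move=> x xrs; rewrite ltNge; apply/negP => /qM[/negP[]].
  by rewrite qE hornerZ mulf_eq0 -!rootE root_prod_XsubC xrs orbT.
have rs_neq x : x \in rs -> x - z0 != 0.
  by move=> /rs_far; rewrite -normc_gt0; apply: lt_trans.
pose us := [seq (x - z0)^-1 | x <- rs].
have us1 : all (fun u => normc u * r < 1) us.
  apply/allP => _ /mapP[x xrs ->]; rewrite normcV mulrC ltr_pdivrMr ?mul1r ?rs_far//.
  by rewrite normc_gt0 rs_neq.
have [rho rho1 us_rho] : exists2 rho, rho < 1 & {in us, forall u, normc u * r <= rho}.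
  elim: (us) us1 => [_|u us' IH /= /andP[u1 /IH[rho rho1 us_rho]]]; first by exists 0.
  exists (Num.max (normc u * r) rho); first by rewrite gt_max u1.
  move=> v; rewrite inE => /orP[/eqP ->|/us_rho h]; first by rewrite le_max lexx.
  by rewrite le_max h orbT.
have S : q^`().[z0] = - q.[z0] * \sum_(u <- us) u.
  rewrite {1}qE derivZ hornerZ horner_deriv_prod_XsubC.
    rewrite mulrA -hornerZ -qE mulNr -mulrN big_map -sumrN; congr (_ * _).
    by apply: eq_bigr => x _; rewrite -invrN opprB.
  by apply/allP => x /rs_neq; rewrite subr_eq0 eq_sym.
have ratio z : q.[z0 + z] = q.[z0] * \prod_(u <- us) (1 - u * z).
  rewrite qE !hornerZ /p !horner_prod big_map -mulrA; congr (_ * _).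
  rewrite -big_split/= [LHS]big_seq [RHS]big_seq; apply: eq_bigr => x xrs.
  by rewrite !hornerXsubC; field; exact: rs_neq.
rewrite S normcM normcN -!mulrA [leRHS]mulrCA.
rewrite ler_pM2l//.
apply: (caratheodory_root_sum r0 rho1 us_rho) => z zr.
have [qz qzM] : q.[z0 + z] != 0 /\ normc q.[z0 + z] <= M.
  by apply: qM; rewrite addrC addKr.
rewrite ratio normcM in qzM.
have us_pos u : u \in us -> 0 < normc (1 - u * z).
  move=> uus; rewrite normc_gt0; apply/eqP => h; move: qz.
  rewrite ratio; have -> : \prod_(u <- us) (1 - u * z) = 0; last by rewrite mulr0 eqxx.
  by apply/eqP; rewrite prodf_seq_eq0; apply/hasP; exists u => //; rewrite h eqxx.
have -> : \sum_(u <- us) ln (normc (1 - u * z)) =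
    ln (normc (\prod_(u <- us) (1 - u * z))).
  elim: (us) us_pos => [_|u us' IH h]; first by rewrite !big_nil normc1 ln1.
  rewrite !big_cons normcM lnM ?posrE ?IH ?h ?mem_head//.
    by move=> v vus; apply: h; rewrite inE vus orbT.
  rewrite normc_prod big_seq prodr_gt0// => v vus.
  by apply: h; rewrite inE vus orbT.
rewrite ler_ln ?posrE.
- by rewrite ler_pdivlMr// mulrC.
- rewrite normc_gt0; move: qz; rewrite ratio; apply: contraNneq => ->.
  by rewrite mulr0.
- rewrite divr_gt0//; apply: lt_le_trans qzM.
  by rewrite -normcM -ratio normc_gt0.
Qed.

Lemma poly_mean_value (q : {poly R[i]}) z (eta : R) :
  (forall t : R, 0 <= t -> t <= 1 -> normc q^`().[t%:C%C * z] <= eta) ->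
  normc (q.[z] - q.[0]) <= eta * normc z.
Proof.
move=> q'; set d := q.[z] - q.[0]; have [d0|d0] := eqVneq d 0.
  rewrite d0 normc0 mulr_ge0 ?normc_ge0//.
  by apply: le_trans (q' 0 _ _); rewrite ?normc_ge0.
pose g : {poly R} := \sum_(k < size q) complex.Re (d^*%C * (q`_k * z ^+ k)) *: 'X^k.
have gE t : g.[t] = complex.Re (d^*%C * q.[t%:C%C * z]).
  rewrite horner_sum horner_coef mulr_sumr Re_sum; apply: eq_bigr => k _.
  rewrite hornerZ hornerXn exprMn -rmorphXn mulrC -ReZ; congr complex.Re.
  by rewrite mulrCA; congr (_ * _); rewrite mulrCA.
have derivs (S : comNzRingType) (p : {poly S}) (c : nat -> S) n :
    p = \sum_(k < n) c k *: 'X^k -> p^`() = \sum_(k < n) (c k *+ k) *: 'X^(k.-1).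
  move=> ->; rewrite raddf_sum; apply: eq_bigr => k _ /=.
  by rewrite derivZ derivXn -scalerMnr scalerMnl.
have g'E t : g^`().[t] = complex.Re (d^*%C * (q^`().[t%:C%C * z] * z)).
  rewrite (derivs _ _ (fun k => complex.Re (d^*%C * (q`_k * z ^+ k))) _ erefl).
  have -> := derivs _ q (fun k => q`_k) (size q); last by rewrite -poly_def coefK.
  rewrite !horner_sum mulr_suml mulr_sumr Re_sum; apply: eq_bigr => -[[|k] kq] _ /=.
    by rewrite mulr0n !scale0r !horner0 mul0r mulr0.
  rewrite !hornerZ !hornerXn exprMn -rmorphXn mulrC.
  rewrite -ReMn -ReZ; congr complex.Re.
  rewrite -[(d^*%C * _) *+ _]mulr_natl -[q`_k.+1 *+ _]mulr_natl exprS; ring.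
have [t t01 E] := @MVT_segment R (horner g) (horner g^`()) 0 1 ler01
  (fun x _ => is_derive_poly g x) (continuous_subspaceT (@continuous_horner R g)).
have : normc d ^+ 2 <= normc d * (eta * normc z).
  have -> : normc d ^+ 2 = g.[1] - g.[0].
    rewrite !gE rmorph1 rmorph0 mul1r mul0r.
    have <- := ReN; rewrite -ReD -mulrN -mulrDr -/d.
    by rewrite [_ * d]mulrC mul_conjc.
  rewrite E subr0 mulr1 g'E.
  apply: le_trans (ler_norm _) _; apply: le_trans (abs_Re_normc _) _.
  rewrite !normcM normcJ ler_wpM2l ?normc_ge0// ler_wpM2r ?normc_ge0//.
  by move: t01; rewrite in_itv/= => /andP[]; exact: q'.
by rewrite expr2 ler_pM2l// normc_gt0.
Qed.

(** On a disk of large radius r around a point w, the bound of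
    [deriv_le_of_zero_free] for the derivative at w of an approximating
    polynomial is of order eps, since ln |phi| is at most eps times the radius
    up to a constant.  By the mean value inequality phi varies by
    O(eps) between 0 and z. *)
Theorem zero_free_minimal_type_const (phi : R[i] -> R[i]) (q : nat -> {poly R[i]}) :
  (forall r eps : R, 0 < eps -> exists n, forall z, normc z <= r ->
     normc ((q n).[z] - phi z) <= eps) ->
  (forall r : R, exists2 delta : R, 0 < delta &
     forall z, normc z <= r -> delta <= normc (phi z)) ->
  (forall eps : R, 0 < eps -> exists C : R, forall z,
     normc (phi z) <= C * expR (eps * normc z)) ->
  forall z, phi z = phi 0.
Proof.
move=> q_phi phi_neq0 phi_type z.
pose rho := normc z; have rho0 : 0 <= rho by exact: normc_ge0.
have [delta delta0 phi_ge] := phi_neq0 rho.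
have [C1 phi_C1] := phi_type 1 ltr01.
have C1_ge0 : 0 <= C1.
  have := phi_C1 0; rewrite normc0 mulr0 expR0 mulr1; exact/le_trans/normc_ge0.
pose B := C1 * expR rho + 1.
have B0 : 0 < B by rewrite ltr_wpDl// mulr_ge0// expR_ge0.
have phi_B w : normc w <= rho -> normc (phi w) + 1 <= B.
  move=> wr; rewrite lerD2r; apply: le_trans (phi_C1 w) _.
  by rewrite ler_wpM2l// ler_expR mul1r.
suff key eps : 0 < eps -> normc (phi z - phi 0) <= (4 * B * rho + 2) * eps.
  apply/eqP; rewrite -subr_eq0; apply/negPn; rewrite -normc_gt0; apply/negP => x0.
  have K0 : 0 < 4 * B * rho + 2 by rewrite ltr_wpDl// !mulr_ge0// ltW.
  have := key (normc (phi z - phi 0) / (2 * (4 * B * rho + 2))).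
  rewrite invfM mulrA [X in _ <= X]mulrC divfK ?gt_eqF//.
  by rewrite divr_gt0 ?mulr_gt0// => /(_ isT); lra.
move=> eps0; have [C phi_C] := phi_type eps eps0.
have C_ge0 : 0 <= C.
  have := phi_C 0; rewrite normc0 mulr0 expR0 mulr1; exact/le_trans/normc_ge0.
pose D := ln (2 * (C + 1) / delta) + eps * rho.
(* The radius is chosen so that the constant D is absorbed by eps * r. *)
pose r := `|D| / eps + 1.
have r0 : 0 < r by rewrite ltr_wpDl// divr_ge0// ltW.
have Dr : D <= eps * r.
  rewrite /r mulrDr mulr1 mulrCA divff ?gt_eqF// mulr1.
  by rewrite (le_trans (ler_norm _))// lerDl ltW.
have [delta' delta'0 phi_ge'] := phi_neq0 (rho + r).
pose err := Num.min (Num.min (delta / 2) (delta' / 2)) (Num.min eps 1).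
have err0 : 0 < err by rewrite !lt_min eps0 ltr01 !divr_gt0.
have [errd errd' erre err1] : [/\ err <= delta / 2, err <= delta' / 2, err <= eps & err <= 1].
  by rewrite /err !ge_min !lexx ?orbT.
have [n q_err] := q_phi (rho + r) err err0.
pose M := (C + 1) * expR (eps * (rho + r)).
have phi_q w : normc w <= rho + r -> normc (phi w) - err <= normc (q n).[w].
  move=> /q_err h; rewrite lerBlDr.
  have := le_normcD (q n).[w] (phi w - (q n).[w]); rewrite addrC subrK => /le_trans; apply.
  by rewrite lerD2l normcB.
have q_phi_le w : normc w <= rho + r -> normc (q n).[w] <= normc (phi w) + err.
  move=> /q_err h; have := le_normcD (phi w) ((q n).[w] - phi w).
  by rewrite addrC subrK => /le_trans; apply; rewrite lerD2l.
have q' w : normc w <= rho -> normc (q n)^`().[w] <= 4 * B * eps.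
  move=> wr; have wr' : normc w <= rho + r by rewrite (le_trans wr)// lerDl ltW.
  have qw_ge : delta / 2 <= normc (q n).[w].
    by have := phi_q w wr'; have := phi_ge w wr; lra.
  have qw_le : normc (q n).[w] <= B.
    by have := q_phi_le w wr'; have := phi_B w wr; lra.
  have qw0 : 0 < normc (q n).[w] by apply: lt_le_trans qw_ge; rewrite divr_gt0.
  have disk x : normc (x - w) <= r -> (q n).[x] != 0 /\ normc (q n).[x] <= M.
    move=> xw; have xr : normc x <= rho + r.
      by have := le_normcD w (x - w); rewrite addrC subrK; move: xw wr; lra.
    split.
      rewrite -normc_gt0; have := phi_q x xr; have := phi_ge' x xr; lra.
    apply: le_trans (q_phi_le x xr) _; rewrite /M mulrDl mul1r; apply: lerD.
      apply: le_trans (phi_C x) _; rewrite ler_wpM2l// ler_expR ler_pM2l//.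
    apply: le_trans err1 _; rewrite -expR0 ler_expR mulr_ge0 ?(ltW eps0)//.
    by rewrite addr_ge0 ?(ltW r0).
  have h := deriv_le_of_zero_free r0 disk.
  have lnM : ln (M / normc (q n).[w]) <= 2 * eps * r.
    have M0 : 0 < M by rewrite mulr_gt0 ?expR_gt0// ltr_wpDl.
    apply: (@le_trans _ _ (ln (2 * (C + 1) / delta * expR (eps * (rho + r))))).
      rewrite ler_ln ?posrE ?divr_gt0 ?mulr_gt0 ?expR_gt0 ?invr_gt0 ?ltr_wpDl//.
      rewrite /M ler_pdivrMr//.
      have -> : (C + 1) * expR (eps * (rho + r)) =
          2 * (C + 1) / delta * expR (eps * (rho + r)) * (delta / 2).
        by field; rewrite gt_eqF.
      by rewrite ler_wpM2l// !mulr_ge0 ?expR_ge0 ?invr_ge0 ?addr_ge0// ltW.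
    rewrite lnM ?posrE ?divr_gt0 ?mulr_gt0 ?expR_gt0 ?ltr_wpDl// expRK.
    by move: Dr; rewrite /D; lra.
  rewrite -(ler_pM2r r0); apply: le_trans h _.
  apply: (@le_trans _ _ (2 * B * (2 * eps * r))); last by lra.
  apply: (@le_trans _ _ (2 * normc (q n).[w] * (2 * eps * r))).
    by rewrite ler_wpM2l// mulr_ge0 ?normc_ge0.
  by rewrite ler_wpM2r ?ler_pM2l// !mulr_ge0 ?(ltW eps0) ?(ltW r0).
have mv : normc ((q n).[z] - (q n).[0]) <= 4 * B * eps * rho.
  apply: poly_mean_value => t t0 t1; apply: q'.
  by rewrite normcM normc_real ger0_norm// ler_piMl.
have zr : normc z <= rho + r by rewrite lerDl ltW.
have := q_err z zr; have := q_err 0; rewrite normc0 => /(_ (addr_ge0 rho0 (ltW r0))).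
have -> : phi z - phi 0 = ((q n).[z] - (q n).[0]) +
   (((q n).[0] - phi 0) - ((q n).[z] - phi z)) by ring.
move=> h1 h2; apply: le_trans (le_normcD _ _) _.
have := le_normcD ((q n).[0] - phi 0) (- ((q n).[z] - phi z)); rewrite normcN.
have -> : (4 * B * rho + 2) * eps = 4 * B * eps * rho + (eps + eps) by ring.
move=> h3; apply: lerD => //; apply: le_trans h3 _; apply: lerD.
  exact: le_trans h1 erre.
exact: le_trans h2 erre.
Qed.
End Liouville.

(** * The inner product of square-summable sequences *)

Section L2Dot.
Variable R : realType.
Implicit Types x y w : l2 R.
Local Notation e := (@l2basis R).

Definition partial_dot (x y : nat -> R[i]) n : R[i] := \sum_(k < n) x k * (y k)^*%C.

(** The triangle inequality for the sequences of moduli, squared. *)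
Lemma sum_normcM_le (x y : nat -> R[i]) n :
  \sum_(k < n) normc (x k) * normc (y k) <=
  Num.sqrt (sqnorm_series x n) * Num.sqrt (sqnorm_series y n).
Proof.
pose ax k := (normc (x k))%:C%C; pose ay k := (normc (y k))%:C%C.
have E (v : nat -> R[i]) : sqnorm_series (fun k => (normc (v k))%:C%C) n = sqnorm_series v n.
  by apply: eq_bigr => k _; rewrite normc_real ger0_norm ?normc_ge0.
have := sqnorm_series_triangle ax ay n.
rewrite -(ler_pXn2r (n := 2)) ?nnegrE ?sqrtr_ge0 ?addr_ge0 ?sqrtr_ge0//.
rewrite sqr_sqrtr ?sqnorm_series_ge0// sqrrD !sqr_sqrtr ?sqnorm_series_ge0// !E.
have -> : sqnorm_series (ax + ay) n = sqnorm_series x n + sqnorm_series y n +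
    2 * \sum_(k < n) normc (x k) * normc (y k).
  rewrite /sqnorm_series /series/= !big_mkord mulr_sumr -!big_split/=.
  apply: eq_bigr => k _; transitivity ((normc (x k) + normc (y k)) ^+ 2); last by ring.
  congr (_ ^+ 2); rewrite -[RHS]ger0_norm ?addr_ge0 ?normc_ge0//.
  by rewrite -normc_real rmorphD.
by rewrite mulr2n; lra.
Qed.

(** This transfers bounds on partial sums to the inner product, whose real and
    imaginary parts are separate limits. *)
Lemma l2dot_closed x y c (M : R) N :
  (forall n, (N <= n)%N -> normc (c - partial_dot x y n) <= M) ->
  normc (c - l2dot x y) <= M.
Proof.
move=> cM; have [cRe cIm] := l2dot_is_cvg x y.
pose u n := complex.Re c - series (fun k => complex.Re (x k * (y k)^*%C)) n.
pose v n := complex.Im c - series (fun k => complex.Im (x k * (y k)^*%C)) n.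
have cv : (fun n => Num.sqrt (u n ^+ 2 + v n ^+ 2)) @ \oo --> normc (c - l2dot x y).
  have -> : normc (c - l2dot x y) = Num.sqrt
      ((complex.Re c - limn (series (fun k => complex.Re (x k * (y k)^*%C)))) ^+ 2 +
       (complex.Im c - limn (series (fun k => complex.Im (x k * (y k)^*%C)))) ^+ 2).
    by rewrite /l2dot; case: (c).
  apply: continuous_cvg; first exact: sqrt_continuous.
  by apply: cvgD; rewrite !expr2; [rewrite (_ : (fun _ => _) = u \* u)|
    rewrite (_ : (fun _ => _) = v \* v)] => //; apply: cvgM; apply: cvgB => //; exact: cvg_cst.
rewrite -(cvg_lim _ cv)//; apply: limr_le; first by apply/cvg_ex; eexists; exact: cv.
near=> n; apply: le_trans (cM n _); last by near: n; exact: nbhs_infty_ge.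
have -> : c - partial_dot x y n = (u n +i* v n)%C.
  rewrite /u /v /series/= !big_mkord -Re_sum -Im_sum /partial_dot.
  by case: (c) => a b; case: (\sum_(k < n) _) => a' b'.
by [].
Unshelve. all: by end_near.
Qed.

Lemma l2dot_unique x y c : (exists N, forall n, (N <= n)%N -> partial_dot x y n = c) ->
  l2dot x y = c.
Proof.
move=> [N xyc]; apply/eqP; rewrite eq_sym -subr_eq0 -normc_eq0 eq_le normc_ge0 andbT.
by apply: (@l2dot_closed _ _ _ _ N) => n /xyc ->; rewrite subrr normc0.
Qed.

(** The Cauchy-Schwarz inequality on tails.  The bound depends on x only
    through its norm, which makes the approximation of the multiplier by
    polynomials uniform on disks. *)
Lemma l2dot_tail x y n :
  normc (partial_dot x y n - l2dot x y) <=
  l2norm x * Num.sqrt (limn (sqnorm_series y) - sqnorm_series y n).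
Proof.
apply: (@l2dot_closed _ _ _ _ n) => m nm.
have -> : partial_dot x y n - partial_dot x y m =
    - \sum_(k < m - n) x (k + n)%N * (y (k + n)%N)^*%C.
  rewrite /partial_dot -!(big_mkord xpredT (fun k => x k * (y k)^*%C)).
  rewrite [X in _ - X](big_cat_nat (n := n))//= opprD addrA subrr add0r.
  by rewrite -{1}[n]add0n big_addn big_mkord.
rewrite normcN; apply: le_trans (normc_sum _ _ _) _.
under eq_bigr do rewrite normcM normcJ.
apply: le_trans (sum_normcM_le (fun k => x (k + n)%N) (fun k => y (k + n)%N) _) _.
have E (v : nat -> R[i]) : sqnorm_series (fun k => v (k + n)%N) (m - n) =
    sqnorm_series v m - sqnorm_series v n.
  rewrite /sqnorm_series /series/= [X in _ = X - _](big_cat_nat (n := n))//=.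
  rewrite addrAC subrr add0r.
  by rewrite -[in RHS](add0n n) big_addn.
rewrite !E; apply: ler_pM; rewrite ?sqrtr_ge0//; apply: ler_wsqrtr.
  apply: (@le_trans _ _ (sqnorm_series x m)).
    by rewrite lerBlDr lerDl sqnorm_series_ge0.
  by apply: sqnorm_series_le_lim; exact: l2P.
by rewrite lerD2r; apply: sqnorm_series_le_lim; exact: l2P.
Qed.

Lemma l2dot_cauchy_schwarz x y : normc (l2dot x y) <= l2norm x * l2norm y.
Proof.
have := l2dot_tail x y 0; rewrite /partial_dot big_ord0 sub0r normcN.
by rewrite {2}/sqnorm_series /series/= big_geq// subr0.
Qed.

Lemma l2dot_near x y (eps : R) : 0 < eps ->
  exists N, forall n, (N <= n)%N -> normc (partial_dot x y n - l2dot x y) <= eps.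
Proof.
move=> eps0; have [X0|X0] := eqVneq (l2norm x) 0.
  by exists 0%N => n _; apply: le_trans (l2dot_tail _ _ _) _; rewrite X0 mul0r ltW.
have Xp : 0 < l2norm x by rewrite lt_neqAle eq_sym X0 sqrtr_ge0.
have d0 : 0 < (eps / l2norm x) ^+ 2 by rewrite exprn_gt0// divr_gt0.
have /cvgrPdist_le /(_ _ d0)[N _ hN] : cvgn (sqnorm_series y) by exact: l2P.
exists N => n /hN Nn; apply: le_trans (l2dot_tail _ _ _) _.
rewrite -ler_pdivlMl// mulrC -[leRHS]ger0_norm ?divr_ge0 ?(ltW eps0) ?(ltW Xp)//.
rewrite -sqrtr_sqr ler_wsqrtr//.
exact: le_trans (ler_norm _) Nn.
Qed.

Lemma l2dot_linear c x y w : l2dot (c *: x + y) w = c * l2dot x w + l2dot y w.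
Proof.
apply/eqP; rewrite -subr_eq0 -normc_eq0; apply/negPn; rewrite -/(_ != _) negbK.
rewrite eq_le normc_ge0 andbT; apply/ler_addgt0Pr => eps eps0; rewrite add0r.
set d := _ - _; pose K := normc c + 2.
have K0 : 0 < K by rewrite ltr_wpDl// normc_ge0.
have e0 : 0 < eps / K by rewrite divr_gt0.
have [N1 h1] := l2dot_near (c *: x + y) w e0.
have [N2 h2] := l2dot_near x w e0; have [N3 h3] := l2dot_near y w e0.
pose n := maxn N1 (maxn N2 N3).
have := h1 n (leq_maxl _ _); have := h2 n; rewrite !leq_max leqnn orbT => /(_ isT).
have := h3 n; rewrite !leq_max leqnn !orbT => /(_ isT) b3 b2 b1.
have dE : d = - (partial_dot (c *: x + y) w n - l2dot (c *: x + y) w) +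
    (c * (partial_dot x w n - l2dot x w) + (partial_dot y w n - l2dot y w)).
  have -> : partial_dot (c *: x + y) w n = c * partial_dot x w n + partial_dot y w n.
    rewrite /partial_dot mulr_sumr -big_split/=; apply: eq_bigr => k _.
    by rewrite mulrA -mulrDl.
  by rewrite /d; ring.
rewrite dE; apply: le_trans (le_normcD _ _) _; rewrite normcN.
apply: le_trans (lerD (lexx _) (le_normcD _ _)) _; rewrite normcM.
have -> : eps = eps / K + (normc c * (eps / K) + eps / K).
  by rewrite /K; field; rewrite gt_eqF.
by apply: lerD => //; apply: lerD => //; rewrite ler_wpM2l ?normc_ge0.
Qed.

Lemma l2dot0 w : l2dot 0 w = 0.
Proof.
have := l2dot_linear 1 0 0 w; rewrite scale1r addr0 mul1r => /eqP.
by rewrite -subr_eq subrr eq_sym => /eqP.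
Qed.

Lemma l2dotZ c x w : l2dot (c *: x) w = c * l2dot x w.
Proof. by rewrite -[c *: x]addr0 l2dot_linear l2dot0 addr0. Qed.

Lemma l2dotD x y w : l2dot (x + y) w = l2dot x w + l2dot y w.
Proof. by rewrite -{1}[x]scale1r l2dot_linear mul1r. Qed.

Lemma l2dotB x y w : l2dot (x - y) w = l2dot x w - l2dot y w.
Proof. by rewrite l2dotD -scaleN1r l2dotZ mulN1r. Qed.

Lemma l2dot_basisr x n : l2dot x (e n) = x n.
Proof.
apply: l2dot_unique; exists n.+1 => m nm; rewrite /partial_dot.
rewrite (bigD1 (Ordinal nm))//= big1 ?addr0 => [|k kn].
  by rewrite /basis_fun eqxx conjc1 mulr1.
by rewrite /= /basis_fun -[_ == _]/(k == Ordinal nm) (negbTE kn) conjc0 mulr0.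
Qed.

Lemma l2dot_basisl x n : l2dot (e n) x = (x n)^*%C.
Proof.
apply: l2dot_unique; exists n.+1 => m nm; rewrite /partial_dot.
rewrite (bigD1 (Ordinal nm))//= big1 ?addr0 => [|k kn].
  by rewrite /basis_fun eqxx mul1r.
by rewrite /= /basis_fun -[_ == _]/(k == Ordinal nm) (negbTE kn) mul0r.
Qed.

Lemma l2dot_self x : l2dot x x = (l2norm x ^+ 2)%:C%C.
Proof. by rewrite l2dot_norm l2normE rmorphXn. Qed.

Lemma l2norm_ge_coord x n : normc (x n) <= l2norm x.
Proof.
rewrite -[leLHS]ger0_norm ?normc_ge0// -sqrtr_sqr ler_wsqrtr//.
apply: (@le_trans _ _ (sqnorm_series x n.+1)).
  by rewrite /sqnorm_series seriesSr lerDr; exact: sqnorm_series_ge0.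
by apply: sqnorm_series_le_lim; exact: l2P.
Qed.

Lemma l2normZ c x : l2norm (c *: x) = normc c * l2norm x.
Proof.
by apply: (@complexI R); rewrite -[LHS]l2normE normrZ l2normE normr_normc rmorphM.
Qed.

Lemma l2norm_le (x : l2 R) (m : nat -> R) (K : R) : 0 <= K -> (forall n, 0 <= m n) ->
  cvgn (series (fun n => m n ^+ 2)) -> (forall n, normc (x n) <= K * m n) ->
  l2norm x <= K * Num.sqrt (limn (series (fun n => m n ^+ 2))).
Proof.
move=> K0 m0 cm xK.
rewrite -{1}(ger0_norm K0) -sqrtr_sqr -sqrtrM ?sqr_ge0// ler_wsqrtr//.
apply: limr_le; first exact: l2P.
apply: nearW => n; apply: (@le_trans _ _ (K ^+ 2 * series (fun n => m n ^+ 2) n)).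
  rewrite /sqnorm_series /series/= mulr_sumr; apply: ler_sum => k _.
  by rewrite -exprMn lerXn2r ?nnegrE ?normc_ge0// mulr_ge0.
rewrite ler_wpM2l ?sqr_ge0//; apply: nondecreasing_cvgn_le => //.
by apply: nondecreasing_series => k _ _; exact: sqr_ge0.
Qed.

Lemma l2_sum_basisE (a : nat -> R[i]) n m :
  (\sum_(i < n) a i *: e i) m = if (m < n)%N then a m else 0.
Proof.
elim: n => [|n IH]; first by rewrite big_ord0.
rewrite big_ord_recr/= -[LHS]/((\sum_(i < n) a i *: e i) m + a n * (m == n)%:R) IH.
rewrite ltnS; case: (ltngtP m n) => [mn|nm|->].
- by rewrite mulr0 addr0.
- by rewrite mulr0 addr0.
- by rewrite mulr1 add0r.
Qed.

Lemma l2norm_basis k : l2norm (e k) = 1.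
Proof.
have := l2dot_self (e k); rewrite l2dot_basisr /= /basis_fun eqxx.
move=> /(congr1 (@complex.Re R)) /= /esym/eqP.
rewrite sqrf_eq1 => /orP[/eqP//|/eqP h].
have := sqrtr_ge0 (limn (sqnorm_series (e k))).
by rewrite -/(l2norm (e k)) h oppr_ge0 ler10.
Qed.

Lemma l2dot_scale_basisr (x : l2 R) a k : l2dot x (a *: e k) = a^*%C * x k.
Proof.
apply: l2dot_unique; exists k.+1 => m km; rewrite /partial_dot.
have eE i : (a *: e k) i = a * (i == k)%:R by [].
rewrite (bigD1 (Ordinal km))// big1 ?addr0 => [|i ik].
  by rewrite eE /= eqxx mulr1 mulrC addr0.
by rewrite eE -[_ == _]/(i == Ordinal km) (negbTE ik) mulr0 conjc0 mulr0.
Qed.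

End L2Dot.

(** * Eigenvectors of the adjoint of a Jacobi operator *)

Section AdjointEigenvectors.
Variables (R : realType).
Local Notation H := (l2 R).
Local Notation e := (@l2basis R).

(** The vector x lies in the domain of the adjoint of T and is an eigenvector
    for z: this is orthogonality to the range of T minus the conjugate of z. *)
Definition adjoint_eigenvector (T : operator R) (z : R[i]) (x : H) : Prop :=
  forall u v, T (u, v) -> l2dot (v - z^*%C *: u) x = 0.

Lemma adjoint_eigenvector_closure (T : operator R) z x :
  adjoint_eigenvector T z x -> adjoint_eigenvector (closure T) z x.
Proof.
move=> Tx u v /closure_operatorP cT.
apply/eqP; rewrite -normc_eq0 eq_le normc_ge0 andbT.
apply/ler_addgt0Pr => eps eps0; rewrite add0r.
pose K := (1 + normc z) * (l2norm x + 1).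
have n0 : 0 <= l2norm x by exact: sqrtr_ge0.
have z0 := normc_ge0 z.
have K0 : 0 < K by apply: mulr_gt0; lra.
have [u' [v' [Tuv uu' vv']]] := cT _ (divr_gt0 eps0 K0).
have -> : l2dot (v - z^*%C *: u) x = l2dot (v - v') x - z^*%C * l2dot (u - u') x.
  have := Tx _ _ Tuv; rewrite !l2dotB !l2dotZ => /eqP; rewrite subr_eq0 => /eqP ->.
  by ring.
apply: le_trans (le_normcD _ _) _; rewrite normcN normcM normcJ.
apply: (@le_trans _ _ (eps / K * (l2norm x + 1) + normc z * (eps / K * (l2norm x + 1)))).
  have le w : l2norm w < eps / K -> normc (l2dot w x) <= eps / K * (l2norm x + 1).
    move=> /ltW h; apply: le_trans (l2dot_cauchy_schwarz _ _) _.
    by apply: ler_pM => //; [exact: sqrtr_ge0|rewrite lerDl].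
  by apply: lerD; [exact: le|rewrite ler_wpM2l// le].
rewrite le_eqVlt; apply/orP; left; apply/eqP; rewrite /K; field.
by rewrite !gt_eqF//; lra.
Qed.

Lemma jacobi_finite_basis (a b : nat -> R) n : jacobi_finite a b (e n, jacobi_on_basis a b n).
Proof.
exists n.+1, (fun k => (k == n)%:R); congr (_, _).
  rewrite big_ord_recr/= eqxx scale1r big1 ?add0r// => k _.
  by rewrite ltn_eqF// scale0r.
rewrite big_ord_recr/= eqxx scale1r big1 ?add0r// => k _.
by rewrite ltn_eqF// scale0r.
Qed.

Variable s : nat -> R.

Lemma l2dot_jacobi_on_basis z (x : H) n :
  l2dot (jacobi_on_basis (jacobi_a s) (jacobi_b s) n - z^*%C *: e n) x =
  (jacobi_apply s x n - z * x n)^*%C.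
Proof.
rewrite l2dotB l2dotZ /jacobi_on_basis /jacobi_apply !l2dotD !l2dotZ !l2dot_basisl.
have J (c : R) (y : R[i]) : (c%:C%C * y)^*%C = c%:C%C * y^*%C.
  by rewrite conjcM conjc_real.
rewrite conjcB !conjcD !J conjcM; congr (_ + _ + _ - _).
by case: n => [|n]; [rewrite l2dot0 conjc0|rewrite l2dotZ l2dot_basisl J].
Qed.

(** Pairing x with the image of e_n under T minus the conjugate of z gives the
    conjugate of the defect of the recurrence at n
    ([l2dot_jacobi_on_basis]). *)
Lemma adjoint_eigenvector_jacobiP z (x : H) :
  adjoint_eigenvector (jacobi_operator s) z x <->
  forall n, jacobi_apply s x n = z * x n.
Proof.
split=> [Tx n|xz].
  apply/eqP; rewrite -subr_eq0 -conjc_eq0 -l2dot_jacobi_on_basis; apply/eqP.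
  by apply: Tx; apply: subset_closure; exact: jacobi_finite_basis.
apply: adjoint_eigenvector_closure => u v [N [c [-> ->]]].
rewrite scaler_sumr -sumrB; elim: N => [|N IH]; first by rewrite big_ord0 l2dot0.
rewrite big_ord_recr/= l2dotD IH add0r scalerA mulrC -scalerA -scalerBr l2dotZ.
by rewrite l2dot_jacobi_on_basis xz subrr conjc0 mulr0.
Qed.

Lemma adjoint_eigenvector_unitary (U : {linear H -> H}) (T : operator R) z x :
  unitary U -> adjoint_eigenvector T z x ->
  adjoint_eigenvector [set (U p.1, U p.2) | p in T] z (U x).
Proof.
move=> [_ Udot] Tx _ _ [[u v] Tuv [<- <-]] /=.
by rewrite -linearZ -linearB Udot; exact: Tx.
Qed.

End AdjointEigenvectors.

Section EigenvectorFamily.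
Variables (R : realType) (s : nat -> R).
Hypothesis s_indet : indeterminate_moment_sequence s.

Lemma orthopolyC_l2 z : (fun n => orthopolyC s n z) \in @square_summable_pred R.
Proof.
have [m [m0 cm /(_ 1 ltr01)[C C0 PC]]] := orthopoly_minimal_type s_indet.
apply/asboolP; set K := C * expR (1 * normc z).
have K0 : 0 <= K by rewrite mulr_ge0 ?expR_ge0.
apply: (@square_summable_bounded _ _ (K ^+ 2 * limn (series (fun n => m n ^+ 2)))) => n.
apply: (@le_trans _ _ (K ^+ 2 * series (fun n => m n ^+ 2) n)).
  rewrite /sqnorm_series /series/= mulr_sumr; apply: ler_sum => k _.
  by rewrite -exprMn lerXn2r ?nnegrE ?normc_ge0 ?mulr_ge0// PC.
rewrite ler_wpM2l ?sqr_ge0//; apply: nondecreasing_cvgn_le => //.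
by apply: nondecreasing_series => k _ _; exact: sqr_ge0.
Qed.

Definition eigenvector z : l2 R := L2 (orthopolyC_l2 z).

Lemma l2norm_eigenvector_ge1 z : 1 <= l2norm (eigenvector z).
Proof.
have [s0 s_pd _] := s_indet.
by have := l2norm_ge_coord (eigenvector z) 0; rewrite /= orthopolyC0// normc1.
Qed.

Lemma l2norm_eigenvector_minimal_type (eps : R) : 0 < eps ->
  exists2 C : R, 0 < C & forall z, l2norm (eigenvector z) <= C * expR (eps * normc z).
Proof.
move=> eps0; have [m [m0 cm /(_ _ eps0)[C C0 PC]]] := orthopoly_minimal_type s_indet.
set M := Num.sqrt (limn (series (fun n => m n ^+ 2))).
have M0 : 0 <= M by exact: sqrtr_ge0.
exists (C * M + 1) => [|z]; first by rewrite ltr_wpDl// mulr_ge0.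
apply: (@le_trans _ _ (C * expR (eps * normc z) * M)).
  by apply: l2norm_le => // [|n]; [rewrite mulr_ge0 ?expR_ge0|exact: PC].
by rewrite mulrAC ler_wpM2r ?expR_ge0// lerDl.
Qed.

Lemma eigenvectorP z x : adjoint_eigenvector (jacobi_operator s) z x <->
  x = x 0%N *: eigenvector z.
Proof.
have [s0 s_pd _] := s_indet; rewrite adjoint_eigenvector_jacobiP; split=> [xz|->].
  by apply/val_inj/funext => n; rewrite [LHS](jacobi_apply_eigen s_pd s0 xz).
have xE k : (x 0%N *: eigenvector z) k = x 0%N * orthopolyC s k z by [].
move=> n; rewrite xE [RHS]mulrCA -(jacobi_apply_orthopolyC s_pd z n).
rewrite /jacobi_apply !xE; case: n => [|n]; rewrite ?xE; ring.
Qed.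

End EigenvectorFamily.

(** * Operators intertwining two Jacobi operators *)

Section Intertwiner.
Variables (R : realType) (s s' : nat -> R).
Hypothesis s_indet : indeterminate_moment_sequence s.
Hypothesis s'_indet : indeterminate_moment_sequence s'.
Variable U : {linear l2 R -> l2 R}.
Hypothesis U_unitary : unitary U.
Hypothesis U_jacobi :
  jacobi_operator s' = [set (U p.1, U p.2) | p in jacobi_operator s].
Local Notation p := (eigenvector s_indet).
Local Notation p' := (eigenvector s'_indet).
Local Notation e := (@l2basis R).
Local Notation P := (orthopoly s).
Local Notation P' := (orthopoly s').

Let s0 : s 0%N = 1. Proof. by case: s_indet. Qed.
Let s'0 : s' 0%N = 1. Proof. by case: s'_indet. Qed.
Let s_pd : positive_definite s. Proof. by case: s_indet. Qed.
Let s'_pd : positive_definite s'. Proof. by case: s'_indet. Qed.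

(** As P'_0 = 1, the first entry of U p(z) is the scalar phi(z) with
    U p(z) = phi(z) p'(z). *)
Definition multiplier (z : R[i]) : R[i] := U (p z) 0%N.

Lemma unitary_eigenvector z : U (p z) = multiplier z *: p' z.
Proof.
apply/eigenvectorP; rewrite U_jacobi; apply: adjoint_eigenvector_unitary => //.
apply/eigenvectorP; rewrite [X in X *: _](_ : _ = 1) ?scale1r//.
by rewrite /= orthopolyC0.
Qed.

Lemma l2norm_unitary x : l2norm (U x) = l2norm x.
Proof.
have [_ Udot] := U_unitary.
have /(congr1 (@complex.Re R)) := Udot x x; rewrite !l2dot_self /= => h.
by apply/eqP; rewrite -(eqrXn2 (n := 2)) ?sqrtr_ge0// h.
Qed.

Lemma multiplierE z : l2norm (p z) = normc (multiplier z) * l2norm (p' z).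
Proof. by rewrite -l2norm_unitary unitary_eigenvector l2normZ. Qed.

(** With U w = e_0, the multiplier is the inner product of p(z) and w.  So it is
    approximated by polynomials, uniformly on disks, and inherits the growth of
    p(z); [multiplierE] and the bound 1 <= |p(z)| keep it away from 0. *)
Lemma multiplier_const z : multiplier z = multiplier 0.
Proof.
have [Usurj Udot] := U_unitary; have [w Uw] := Usurj (e 0%N).
have mw x : multiplier x = l2dot (p x) w by rewrite -Udot Uw l2dot_basisr.
pose q n : {poly R[i]} := \sum_(k < n) (w k)^*%C *: map_poly (real_complex R) (P k).
have qE n x : (q n).[x] = partial_dot (p x) w n.
  by rewrite horner_sum; apply: eq_bigr => k _; rewrite hornerZ mulrC.
move: z; apply: (zero_free_minimal_type_const (q := q)).
- move=> r eps eps0.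
  have [C C0 pC] := l2norm_eigenvector_minimal_type s_indet ltr01.
  have K0 : 0 < C * expR r by rewrite mulr_gt0 ?expR_gt0.
  have d0 : 0 < (eps / (C * expR r)) ^+ 2 by rewrite exprn_gt0// divr_gt0.
  have /cvgrPdist_le /(_ _ d0)[N _ /(_ N (leqnn N)) hN] :
    cvgn (sqnorm_series w) by exact: l2P.
  exists N => x xr; rewrite qE mw; apply: le_trans (l2dot_tail _ _ _) _.
  have -> : eps = C * expR r * (eps / (C * expR r)) by field; rewrite gt_eqF ?expR_gt0 ?gt_eqF.
  apply: ler_pM; rewrite ?sqrtr_ge0//.
    apply: le_trans (pC x) _; rewrite ler_pM2l// ler_expR mul1r//.
  rewrite -[leRHS]ger0_norm ?divr_ge0 ?(ltW eps0) ?(ltW K0)//.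
  by rewrite -sqrtr_sqr ler_wsqrtr//; exact: le_trans (ler_norm _) hN.
- move=> r; have [C C0 pC] := l2norm_eigenvector_minimal_type s'_indet ltr01.
  have K0 : 0 < C * expR r by rewrite mulr_gt0 ?expR_gt0.
  exists (C * expR r)^-1; first by rewrite invr_gt0.
  move=> x xr; rewrite -[leLHS]mul1r ler_pdivrMr//.
  apply: le_trans (l2norm_eigenvector_ge1 s_indet x) _.
  rewrite multiplierE ler_wpM2l ?normc_ge0//; apply: le_trans (pC x) _.
  by rewrite ler_pM2l// ler_expR mul1r.
- move=> eps eps0; have [C C0 pC] := l2norm_eigenvector_minimal_type s_indet eps0.
  exists (C * l2norm w) => x; rewrite mw; apply: le_trans (l2dot_cauchy_schwarz _ _) _.
  by rewrite mulrAC ler_wpM2r ?sqrtr_ge0.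
Qed.

Let c := multiplier 0.

Lemma multiplier_neq0 : c != 0.
Proof.
rewrite -normc_gt0 lt_neqAle normc_ge0 andbT; apply/eqP => c0.
have := l2norm_eigenvector_ge1 s_indet 0.
by rewrite multiplierE -/c -c0 mul0r ler10.
Qed.

Definition change_of_basis k n : R := mdot s (P' k) (P n).

Lemma change_of_basisE k N : (k < N)%N ->
  P' k = \sum_(n < N) change_of_basis k n *: P n.
Proof.
move=> kN; rewrite -(big_mkord xpredT (fun n => change_of_basis k n *: P n)).
by apply: orthopoly_expansion => //; rewrite size_orthopoly.
Qed.

Lemma change_of_basis_gt k n : (k < n)%N -> change_of_basis k n = 0.
Proof.
move=> kn; rewrite /change_of_basis (change_of_basisE (leqnn k.+1)) mdot_suml big1// => i _.
rewrite mdotZl orthopoly_orthonormal// ltn_eqF ?mulr0//.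
exact: leq_trans (ltn_ord i) kn.
Qed.

(** For real x both sides are coefficients of an expansion of c P'_k(x) in the
    P_n(x).  The difference of the two coefficient sequences is square
    summable, and its expansion tends to 0. *)
Lemma preimage_basis_coef k (w : l2 R) : U w = e k ->
  forall n, w n = c^*%C * (change_of_basis k n)%:C%C.
Proof.
move=> Uw.
pose v : l2 R := w - c^*%C *: \sum_(n < k.+1) (change_of_basis k n)%:C%C *: e n.
have vE n : v n = w n - c^*%C * (change_of_basis k n)%:C%C.
  rewrite /v -[LHS]/(w n - c^*%C * (\sum_(i < k.+1) (change_of_basis k i)%:C%C *: e i) n).
  rewrite (l2_sum_basisE (fun i => (change_of_basis k i)%:C%C)).
  by case: ltnP => // kn; rewrite change_of_basis_gt.
(* Subtracting the candidate inside l2 shows that the differences are square summable. *)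
pose y n := (v n)^*%C.
have yE n : y n = (w n)^*%C - c * (change_of_basis k n)%:C%C.
  by rewrite /y vE conjcB conjcM conjcK conjc_real.
suff y0 : forall n, y n = 0.
  move=> n; apply/eqP; rewrite -subr_eq0 -vE; apply/eqP.
  by rewrite -[v n]conjcK -/(y n) y0 conjc0.
have dotw (x : R) : l2dot (p x%:C%C) w = c * ((P' k).[x])%:C%C.
  have [_ Udot] := U_unitary.
  rewrite -Udot Uw l2dot_basisr unitary_eigenvector multiplier_const -/c.
  by rewrite -orthopolyC_real.
have part (x : R) N : (k < N)%N ->
    partial_dot (p x%:C%C) w N - l2dot (p x%:C%C) w =
    \sum_(n < N) y n * ((P n).[x])%:C%C.
  move=> kN; rewrite dotw (change_of_basisE kN) horner_sum rmorph_sum mulr_sumr.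
  rewrite /partial_dot -sumrB; apply: eq_bigr => i _ /=.
  by rewrite orthopolyC_real (hornerZ (change_of_basis k i) (P i)) rmorphM yE; ring.
have [mu [nu [mu_s _ _]]] : indeterminate s by case: s_indet.
have lim0 (x : R) (pr : R[i] -> R) : (forall u, `|pr u| <= normc u) ->
    (fun N => pr (\sum_(n < N) y n * ((P n).[x])%:C%C)) @ \oo --> (0 : R).
  move=> pr_le; apply/cvgrPdist_le => eps eps0.
  have [N hN] := l2dot_near (p x%:C%C) w eps0.
  exists (maxn N k.+1) => // m /=; rewrite geq_max => /andP[Nm km].
  rewrite sub0r normrN; apply: le_trans (pr_le _) _.
  by rewrite -part//; exact: hN.
have cy (pr : R[i] -> R) : (forall u, `|pr u| <= normc u) ->
    cvgn (series (fun n => pr (y n) ^+ 2)).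
  move=> pr_le; apply: (@series_le_cvg _ _ (fun n => normc (v n) ^+ 2)).
  - by move=> n; exact: sqr_ge0.
  - by move=> n; exact: sqr_ge0.
  - move=> n; have -> : pr (y n) ^+ 2 = `|pr (y n)| ^+ 2 by rewrite real_normK ?num_real.
    by rewrite lerXn2r ?nnegrE ?normc_ge0// (le_trans (pr_le _))// /y normcJ.
  - exact: l2P.
have yRe := orthopoly_series_unique mu_s s_pd (cy _ (@abs_Re_normc R)).
have yIm := orthopoly_series_unique mu_s s_pd (cy _ (@abs_Im_normc R)).
move=> n; apply/eqP; rewrite eq_complex; apply/andP; split; apply/eqP.
  apply: yRe => x; rewrite (_ : (fun _ => _) = (fun N =>
    complex.Re (\sum_(i < N) y i * ((P i).[x])%:C%C))); first exact/lim0/abs_Re_normc.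
  apply/funext => N; rewrite Re_sum; apply: eq_bigr => i _.
  by rewrite [y i * _]mulrC ReZ mulrC.
apply: yIm => x; rewrite (_ : (fun _ => _) = (fun N =>
    complex.Im (\sum_(i < N) y i * ((P i).[x])%:C%C))); first exact/lim0/abs_Im_normc.
apply/funext => N; rewrite Im_sum; apply: eq_bigr => i _.
by rewrite [y i * _]mulrC ImZ mulrC.
Qed.

Lemma preimage_basis_support k (w : l2 R) : U w = e k ->
  (forall n, n != k -> w n = 0) -> w = (c^*%C * (change_of_basis k k)%:C%C) *: e k /\
  normc c * `|change_of_basis k k| = 1.
Proof.
move=> Uw wk.
have wE : w = (c^*%C * (change_of_basis k k)%:C%C) *: e k.
  rewrite -(preimage_basis_coef Uw k); apply/val_inj/funext => n.
  rewrite -[RHS]/(w k * (n == k)%:R); have [->|nk] := eqVneq n k; first by rewrite mulr1.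
  by rewrite mulr0; exact: wk.
split=> //; have : l2norm w = 1 by rewrite -l2norm_unitary Uw l2norm_basis.
by rewrite wE l2normZ l2norm_basis mulr1 normcM normcJ normc_real.
Qed.

(** Compare the norms of e_0 and of its preimage, using P'_0 = P_0 = 1. *)
Lemma multiplier_unimodular : normc c = 1.
Proof.
have [Usurj _] := U_unitary; have [w Uw] := Usurj (e 0%N).
have [|_ ] := preimage_basis_support Uw.
  move=> n n0; rewrite (preimage_basis_coef Uw) change_of_basis_gt ?lt0n//.
  by rewrite rmorph0 mulr0.
have -> : change_of_basis 0 0 = 1.
  rewrite /change_of_basis orthopoly0// -(orthopoly0 s_pd s0).
  by rewrite orthopoly_orthonormal.
by rewrite normr1 mulr1.
Qed.

(** By induction w is orthogonal to the preimages of e_n for n < k, which are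
    multiples of e_n, while its entries beyond k vanish by triangularity.  So
    P' k is a multiple of P k, by a factor of modulus 1 that is positive. *)
Lemma preimage_basis k (w : l2 R) : U w = e k -> w = c^*%C *: e k.
Proof.
elim/ltn_ind: k w => k IH w Uw.
have [Usurj Udot] := U_unitary.
have c0 : c^*%C != 0 by rewrite conjc_eq0 multiplier_neq0.
have wk n : n != k -> w n = 0.
  rewrite neq_ltn => /orP[nk|kn]; last first.
    by rewrite (preimage_basis_coef Uw) change_of_basis_gt// rmorph0 mulr0.
  have [v Uv] := Usurj (e n).
  have : l2dot v w = 0.
    by rewrite -Udot Uw Uv l2dot_basisr /= /basis_fun gtn_eqF.
  rewrite (IH n nk v Uv) l2dotZ l2dot_basisl => /eqP.
  by rewrite mulf_eq0 (negbTE c0)/= conjc_eq0 => /eqP.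
have [-> ] := preimage_basis_support Uw wk.
rewrite multiplier_unimodular mul1r => nk.
suff pos : 0 < change_of_basis k k.
  by move: nk; rewrite gtr0_norm// => ->; rewrite rmorph1 mulr1.
have : P' k = change_of_basis k k *: P k.
  rewrite (change_of_basisE (leqnn k.+1)) big_ord_recr/= big1 ?add0r// => i _.
  have /eqP := preimage_basis_coef Uw i; rewrite wk ?ltn_eqF// eq_sym mulf_eq0.
  by rewrite (negbTE c0)/= fmorph_eq0 => /eqP ->; rewrite scale0r.
move=> /(congr1 lead_coef); rewrite (lead_coefZ (change_of_basis k k) (P k)) => h.
have := lead_coef_orthopoly s'_pd k; rewrite h pmulr_lgt0//.
exact: lead_coef_orthopoly.
Qed.

(** The entry of U x of index k is its inner product with e k = U w, hence that
    of x with w. *)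
Lemma intertwiner_scalar x : U x = c *: x.
Proof.
have [Usurj Udot] := U_unitary; apply/val_inj/funext => k.
have [w Uw] := Usurj (e k).
transitivity (l2dot (U x) (e k)); first by rewrite l2dot_basisr.
by rewrite -Uw Udot (preimage_basis Uw) l2dot_scale_basisr conjcK.
Qed.

End Intertwiner.

Lemma jacobi_operatorZ (R : realType) (s : nat -> R) (c : R[i]) u v :
  jacobi_operator s (u, v) -> jacobi_operator s (c *: u, c *: v).
Proof.
move=> /closure_operatorP Tuv; apply/closure_operatorP => eps eps0.
pose K := normc c + 1; have K0 : 0 < K by rewrite ltr_wpDl ?normc_ge0.
have [u' [v' [[N [a [-> ->]]] uu vv]]] := Tuv _ (divr_gt0 eps0 K0).
have cle (x : l2 R) : l2norm x < eps / K -> l2norm (c *: x) < eps.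
  rewrite l2normZ ltr_pdivlMr// => h; apply: le_lt_trans h.
  by rewrite mulrC ler_wpM2l ?sqrtr_ge0// /K lerDl.
exists (c *: \sum_(n < N) a n *: l2basis R n),
  (c *: \sum_(n < N) a n *: jacobi_on_basis (jacobi_a s) (jacobi_b s) n); split.
- exists N, (fun n => c * a n); congr (_, _); rewrite scaler_sumr;
    by apply: eq_bigr => n _; rewrite scalerA.
- by rewrite -scalerBr; exact: cle.
- by rewrite -scalerBr; exact: cle.
Qed.

Theorem theorem8p5 (R : realType) (s s' : nat -> R)
  (hs : indeterminate_moment_sequence s)
  (hs' : indeterminate_moment_sequence s')
  (hU : unitarily_equivalent (jacobi_operator s) (jacobi_operator s')) :
  jacobi_operator s' = jacobi_operator s.
Proof.
have [U [U_unitary U_jacobi]] := hU.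
have c0 := multiplier_neq0 hs hs' U_unitary U_jacobi.
have Uc := intertwiner_scalar hs hs' U_unitary U_jacobi.
rewrite U_jacobi; apply/seteqP; split=> [_ [[u v] Tuv <-]|[u v] Tuv] /=.
  by rewrite !Uc; exact: jacobi_operatorZ.
set c := multiplier _ _ _ in c0 Uc.
exists (c^-1 *: u, c^-1 *: v); first exact: jacobi_operatorZ.
by rewrite /= !Uc !scalerA divff// !scale1r.
Qed.
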